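(* Let $d\ge1$ and let $(V_\gamma)_{\gamma>0}$ be a family of i.i.d. non-negative potentials $V_\gamma=(V_\gamma(x))_{x\in\mathbb{Z}^d}$ with $\mathbb{P}[V_\gamma(0)>0]>0$ for all $\gamma>0$. Assume that $V_\gamma(0)/\gamma$ converges in distribution as $\gamma\searrow0$ to some random variable $V$, where $\mathbb{E}[V]$ may be infinite. Then for all $\ell\in\mathbb{R}^d$, $$\liminf_{\gamma\searrow0}\frac{\beta_{V_\gamma}(\ell)}{\sqrt{\gamma}}\ge\sqrt{2d\,\mathbb{E}[V]}\ \|\ell\|_2 .$$
   Context: For each fixed $\gamma>0$ the random variables $V_\gamma(x)$, $x\in\mathbb{Z}^d$, are i.i.d. under a probability measure $\mathbb{P}$ with expectation $\mathbb{E}$; $\mathbb{E}[V_\gamma(0)]$ is not assumed to be finite. The limit $V$ is a single (real-valued, non-negative) random variable and $\mathbb{E}[V]\in[0,\infty]$ is its expectation. Let $(S(n))_{n\ge0}$ be the symmetric nearest-neighbor random walk on $\mathbb{Z}^d$ started at $0$, defined on a different probability space with measure $P$ and expectation $E$, and let $H(y)=\inf\{n\ge0\mid S(n)=y\}$. For a potential $U=(U(x))_{x\in\mathbb{Z}^d}$ of i.i.d. non-negative random variables with $\mathbb{P}[U(0)>0]>0$ put $$e(0,y,U)=E\Big[\exp\Big(-\sum_{n=0}^{H(y)-1}U(S(n))\Big)\mathbf{1}_{H(y)<\infty}\Big],\qquad y\in\mathbb{Z}^d.$$ Annealed Lyapunov exponent: it is known that there is a (unique) norm $\beta_U$ on $\mathbb{R}^d$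 such that for all $\ell\in\mathbb{Z}^d$, $$\beta_U(\ell)=\lim_{k\to\infty}\frac{-1}{k}\ln\mathbb{E}[e(0,k\ell,U)].$$ Conventions: $\sqrt{\infty}=\infty$ and $\infty\cdot0=0$. *)

(* Defs.v *)
From HB Require Import structures.
From mathcomp Require Import all_boot all_order all_algebra.
From mathcomp Require Import all_classical all_reals all_analysis.

Set Implicit Arguments.
Unset Strict Implicit.
Unset Printing Implicit Defensive.

Import Order.TTheory GRing.Theory Num.Theory.
Import numFieldNormedType.Exports.

Local Open Scope classical_set_scope.
Local Open Scope ring_scope.

Section independence.
Context {disp : measure_display} {T : measurableType disp} {R : realType}.
Variable P : probability T R.

Definition mutually_independent (I : choiceType) (F : I -> set_system T) : Prop :=
  forall J : seq I, uniq J ->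
  forall E : I -> set T, (forall i, i \in J -> F i (E i)) ->
    P (\bigcap_(i in [set` J]) E i) = (\prod_(i <- J) P (E i))%E.

Definition iid (I : choiceType) (X : I -> {RV P >-> R}) : Prop :=
  mutually_independent
    (fun i => preimage_set_system setT (X i) measurable) /\
  forall i j (A : set R), measurable A ->
    P (X i @^-1` A) = P (X j @^-1` A).

End independence.

(* Weak convergence of laws; the X i and Y may live on different spaces. *)
Definition cvg_in_distribution {R : realType} {I : Type} (F : set_system I)
    {dT : measure_display} {T : measurableType dT} (P : probability T R)
    (X : I -> T -> R)
    {dQ : measure_display} {O : measurableType dQ} (Q : probability O R)
    (Y : O -> R) : Prop :=
  forall f : R -> R, continuous f -> (exists M : R, forall x, `|f x| <= M) ->
    ('E_P[f \o X i])%E @[i --> F] --> ('E_Q[f \o Y])%E.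

Section walk.
Context {disp : measure_display} {W : measurableType disp} {R : realType}.
Variables (d : nat) (PW : probability W R) (S : nat -> W -> 'rV[int]_d).

(* Z^d carries the discrete sigma-algebra, hence the system setT of all subsets
   of Z^d in the independence of the increments. *)
Definition simple_random_walk : Prop :=
  [/\ forall w, S 0%N w = 0,
      forall n (y : 'rV[int]_d), measurable (S n @^-1` [set y]),
      forall n (e : 'rV[int]_d), \sum_i `|e ord0 i| = 1 ->
        PW [set w | S n.+1 w - S n w = e] = (((2 * d)%:R : R)^-1)%:E
    & mutually_independent PW (fun n : nat =>
        preimage_set_system setT (fun w => S n.+1 w - S n w) setT)].

(* None stands for an infinite hitting time. *)
Definition hitting_time (s : nat -> 'rV[int]_d) (y : 'rV[int]_d) : option nat :=
  if pselect (exists n, s n == y) is left h then Some (ex_minn h) else None.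

Definition path_weight (U : 'rV[int]_d -> R) (s : nat -> 'rV[int]_d)
    (y : 'rV[int]_d) : R :=
  if hitting_time s y is Some H then expR (- \sum_(0 <= n < H) U (s n)) else 0.

(* e(0, y, U) for a fixed environment U; the walk S starts at 0. *)
Definition two_point (U : 'rV[int]_d -> R) (y : 'rV[int]_d) : \bar R :=
  ('E_PW[fun w => path_weight U (S ^~ w) y])%E.

End walk.

Section lyapunov.
Context {disp : measure_display} {T : measurableType disp} {R : realType}.
Variable P : probability T R.
Context {dispW : measure_display} {W : measurableType dispW}.
Variables (d : nat) (PW : probability W R) (S : nat -> W -> 'rV[int]_d).

Definition annealed_two_point (U : 'rV[int]_d -> T -> R) (y : 'rV[int]_d)
    : \bar R :=
  (\int[P]_w two_point PW S (U ^~ w) y)%E.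

Definition is_norm (N : 'rV[R]_d -> R) : Prop :=
  [/\ forall x, N x = 0 -> x = 0,
      forall a x, N (a *: x) = `|a| * N x
    & forall x y, N (x + y) <= N x + N y].

(* N is the annealed Lyapunov exponent beta_U. At most one N qualifies: the
   limits fix N on Z^d, homogeneity on Q^d and continuity on R^d. *)
Definition annealed_lyapunov (U : 'rV[int]_d -> T -> R) (N : 'rV[R]_d -> R)
    : Prop :=
  is_norm N /\
  forall l : 'rV[int]_d,
    ((- (k%:R : R)^-1)%:E * lne (annealed_two_point U (l *+ k)))%E
      @[k --> \oo] --> (N (map_mx intr l))%:E.

End lyapunov.

(* The library norm on 'rV[R]_d is the sup norm. *)
Definition l2norm {R : realType} {d : nat} (x : 'rV[R]_d) : R :=
  Num.sqrt (\sum_i x ord0 i ^+ 2).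

(* Main.v *)
Require Import Defs.
From HB Require Import structures.
From mathcomp Require Import all_boot all_order all_algebra.
From mathcomp Require Import all_classical all_reals all_analysis.
From mathcomp Require Import measurable_realfun ring lra.

Import Order.TTheory GRing.Theory Num.Theory.
Import numFieldNormedType.Exports.

Local Open Scope classical_set_scope.
Local Open Scope ring_scope.

Set Implicit Arguments.
Unset Strict Implicit.
Unset Printing Implicit Defensive.

(** Averaging over the environment turns the two-point function into the
    expectation, over walks hitting [y], of a product over sites [x] of the
    Laplace transform of the potential at the number of visits to [x]. For small
    [g], the Laplace transform at [n] is at most [exp (- c g n)] as long as [n]
    is at most [N], of order [1 / g], for any fixed [c] below the mean of the
    limit [V0] ([laplace_near]). Hence the walk pays [kappa = c g] for each visit
    to a site that is not yet saturated, that is, visited fewer than [N] times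
    ([annealed_weight_le], [two_point_le]).

    If there were no saturation, [exp (theta (u . S n) - kappa n)] would be a
    martingale for a unit vector [u] and [theta] close to [sqrt (2 d kappa)],
    and the claim would follow with the rate [theta]. Saturation is harmless
    because it is rare at the relevant scale. Cut the space into slabs
    orthogonal to [u], of width [L = r0 / sqrt g]. The walk enters each slab
    unvisited, so by counting in each slab only the visits made while crossing
    it the costs of successive slabs decouple, and the two-point function is at
    most a product of slab factors ([hit_value_le_slabs]). Within one slab,
    and without saturation, the crossing probability is about
    [1 / cosh (theta L)], at most [2 exp (- theta L)]: the walk is killed in the
    slab and free below it. A site of the slab escapes being revisited with probability of order
    [1 / L], so it collects [N] visits with probability of order
    [exp (- const / sqrt g)], which is negligible even after summation over the
    order [L ^ 2] sites that are visited ([saturation_near]). Both effects are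
    encoded in one explicit supersolution, [slab_potential], compared with the
    walk by induction on the number of remaining steps.

    A slab factor is thus at most [3 exp (- s r0)] for every [s ^ 2 < 2 d c] and
    small [g]. The Lyapunov exponent, first on the lattice and then by homogeneity
    and the triangle inequality on the whole space, is at least
    [sqrt g (s - ln 3 / r0)] times the Euclidean norm ([annealed_lyapunov_ge], [lyapunov_ratio_near]).
    Let [g] tend to zero, then [r0] to infinity, and let [c] increase to the
    mean. *)

(** * Steps of the lattice and heights in a direction *)

Section steps.
Context {R : realType} {d : nat}.
Implicit Types (e : 'I_d * bool) (u : 'rV[R]_d) (f g : 'I_d * bool -> R).

Definition unit_step e : 'rV[int]_d := (-1) ^+ e.2 *: delta_mx ord0 e.1.

Definition step_mean f : R := ((2 * d)%:R)^-1 * \sum_e f e.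

Definition dotZ u (z : 'rV[int]_d) : R := \sum_i u ord0 i * (z ord0 i)%:~R.

Lemma dotZD u z z' : dotZ u (z + z') = dotZ u z + dotZ u z'.
Proof.
by rewrite -big_split; apply: eq_bigr => i _; rewrite mxE intrD mulrDr.
Qed.

Lemma dotZ_step u e : dotZ u (unit_step e) = (-1) ^+ e.2 * u ord0 e.1.
Proof.
rewrite /dotZ (bigD1 e.1) //= big1 ?addr0 => [|i ne_ie].
  by rewrite !mxE !eqxx mulr1 rmorphXn rmorphN1 mulrC.
by rewrite !mxE eqxx (negPf ne_ie) mulr0 mulr0.
Qed.

Lemma sum_steps f : \sum_e f e = \sum_i (f (i, false) + f (i, true)).
Proof.
under eq_bigr do rewrite [X in f X]surjective_pairing.
rewrite -(pair_bigA _ (fun i b => f (i, b))) /=.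
by apply: eq_bigr => i _; rewrite big_bool addrC.
Qed.

Lemma ler_step_mean f g : (forall e, f e <= g e) -> step_mean f <= step_mean g.
Proof. by move=> fg; rewrite ler_wpM2l ?invr_ge0//; apply: ler_sum. Qed.

Lemma step_meanD f g :
  step_mean (fun e => f e + g e) = step_mean f + step_mean g.
Proof. by rewrite /step_mean big_split mulrDr. Qed.

Lemma step_meanZ c f : step_mean (fun e => c * f e) = c * step_mean f.
Proof. by rewrite /step_mean -mulr_sumr mulrCA. Qed.

Lemma step_mean_sum (I : Type) (r : seq I) (P : pred I)
    (F : I -> 'I_d * bool -> R) :
  step_mean (fun e => \sum_(i <- r | P i) F i e)
  = \sum_(i <- r | P i) step_mean (F i).
Proof. by rewrite /step_mean exchange_big mulr_sumr. Qed.

Hypothesis d_gt0 : (0 < d)%N.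

Lemma step_mean_cst c : step_mean (fun=> c) = c.
Proof.
have d_neq0 : (2 * d)%:R != 0 :> R by rewrite pnatr_eq0 -lt0n muln_gt0.
rewrite /step_mean sumr_const card_prod card_ord card_bool [(d * 2)%N]mulnC.
by rewrite -[c *+ _]mulr_natl mulKf.
Qed.

Variable u : 'rV[R]_d.
Hypothesis u_unit : \sum_i u ord0 i ^+ 2 = 1.

Lemma coord_le1 i : `|u ord0 i| <= 1.
Proof.
rewrite -(@expr_le1 _ 2) // real_normK ?num_real // -u_unit (bigD1 i) //=.
by rewrite lerDl sumr_ge0 // => j _; rewrite sqr_ge0.
Qed.

Lemma dotZ_step_le1 e : `|dotZ u (unit_step e)| <= 1.
Proof. by rewrite dotZ_step normrM normrX normrN1 expr1n mul1r coord_le1. Qed.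

(** Pair each step with its opposite: the squared coordinates of [u] sum to 1,
    so a second difference of size [A s ^ 2] around the value [C] becomes a drift
    of size [A / (2 d)]. *)
Lemma step_mean_pair (phi : R -> R) (C A t : R) :
  (forall s, `|s| <= 1 -> phi (t + s) + phi (t - s) <= 2 * C + A * s ^+ 2) ->
  step_mean (fun e => phi (t + dotZ u (unit_step e))) <= C + A / (2 * d)%:R.
Proof.
move=> H; rewrite /step_mean sum_steps.
have d2_gt0 : 0 < (2 * d)%:R :> R by rewrite ltr0n muln_gt0.
rewrite mulrC ler_pdivrMr // mulrDl divfK ?gt_eqF //.
have -> : C * (2 * d)%:R + A = \sum_i (2 * C + A * u ord0 i ^+ 2).
  rewrite big_split /= sumr_const card_ord -mulr_sumr u_unit mulr1.
  by rewrite natrM -[_ *+ d]mulr_natr; ring.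
apply: ler_sum => i _; rewrite !dotZ_step /= expr0 mul1r expr1 mulN1r.
exact: H (coord_le1 i).
Qed.

End steps.

(** * Crossing slabs with saturating killing *)

Section cosh.
Context {R : realType}.
Implicit Types x y s : R.

Definition coshR x : R := (expR x + expR (- x)) / 2.

Lemma coshRN x : coshR (- x) = coshR x.
Proof. by rewrite /coshR opprK addrC. Qed.

Lemma coshR_gt0 x : 0 < coshR x.
Proof. by rewrite divr_gt0 // addr_gt0 ?expR_gt0. Qed.

Lemma coshR_mulD x s : coshR (x + s) + coshR (x - s) = 2 * coshR x * coshR s.
Proof. by rewrite /coshR !opprD opprK !expRD; field. Qed.

Lemma ler_coshR x y : 0 <= x -> x <= y -> coshR x <= coshR y.
Proof.
move=> x0 xy; rewrite /coshR ler_pM2r ?invr_gt0 // -subr_ge0.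
have ex := expR_gt0 x; have ey := expR_gt0 y.
have -> : expR y + expR (- y) - (expR x + expR (- x)) =
    (expR y - expR x) * (1 - expR (- x) * expR (- y)).
  by rewrite !expRN; field; rewrite !gt_eqF.
rewrite mulr_ge0 ?subr_ge0 ?ler_expR // -expRD -expR0 ler_expR; lra.
Qed.

Lemma coshR_abs x : coshR `|x| = coshR x.
Proof. by case: (ger0P x) => _ //; rewrite coshRN. Qed.

(** [cosh x - 1 = 2 sinh (x / 2) ^ 2], and [sinh y <= y exp y] for [y >= 0]
    because [exp (- 2 y) >= 1 - 2 y]. *)
Lemma coshR_le x : coshR x <= 1 + x ^+ 2 / 2 * expR `|x|.
Proof.
wlog x0 : x / 0 <= x => [H|].
  rewrite -coshR_abs -[`|x| in X in _ <= X]normr_id -[x ^+ 2]real_normK ?num_real //.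
  exact: H.
rewrite ger0_norm //; pose y := x / 2.
have -> : x = y + y by rewrite /y; field.
have ey := expR_gt0 y.
have sinh_le : expR y - expR (- y) <= 2 * y * expR y.
  have := expR_ge1Dx (- (y + y)); rewrite expRN expRD => H.
  rewrite expRN -subr_ge0; have -> : 2 * y * expR y - (expR y - (expR y)^-1) =
    expR y * ((expR y * expR y)^-1 - (1 - (y + y))) by field; rewrite gt_eqF.
  apply: mulr_ge0; first exact: ltW.
  by rewrite subr_ge0 (le_trans _ H) //; lra.
have y0 : 0 <= y by rewrite divr_ge0.
have sinh_ge0 : 0 <= expR y - expR (- y) by rewrite subr_ge0 ler_expR; lra.
have -> : coshR (y + y) = 1 + (expR y - expR (- y)) ^+ 2 / 2.
  by rewrite /coshR opprD !expRD expRN; field; rewrite gt_eqF.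
rewrite lerD2l expRD.
have -> : (y + y) ^+ 2 / 2 * (expR y * expR y) = (2 * y * expR y) ^+ 2 / 2
  by field.
by rewrite ler_pM2r ?invr_gt0 // ler_sqr ?nnegrE // (le_trans sinh_ge0).
Qed.

End cosh.

Section hit_value.
Context {R : realType} {d : nat}.
Variables (kappa : R) (N : nat) (y : 'rV[int]_d).
Implicit Types (z x : 'rV[int]_d) (h : seq 'rV[int]_d).

(** Averaging over the random potential of a site costs as much as the constant
    potential [kappa] only for a limited number of visits; later visits are left
    free of charge. *)
Definition visit_weight z h : R :=
  if (count_mem z h < N)%N then expR (- kappa) else 1.

(** The past [h] is part of the state because the weights depend on it. The
    horizon [M] makes every quantity a finite recursion on histories; bounds
    uniform in [M] and in the past then replace the strong Markov property. *)
Fixpoint hit_value (M : nat) z h : R :=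
  if z == y then 1 else
  if M is M'.+1 then
    visit_weight z h *
      step_mean (fun e => hit_value M' (z + unit_step e) (z :: h))
  else 0.

End hit_value.

Section slab.
Context {R : realType} {d : nat}.
Hypothesis d_gt0 : (0 < d)%N.
Variable u : 'rV[R]_d.
Hypothesis u_unit : \sum_i u ord0 i ^+ 2 = 1.
Variables (kappa theta L : R) (N : nat).
Hypotheses (kappa_ge0 : 0 <= kappa) (theta_ge0 : 0 <= theta) (L_ge1 : 1 <= L).
Hypothesis N_gt0 : (0 < N)%N.
Hypothesis theta_small : theta ^+ 2 * expR theta <= (2 * d)%:R * kappa.
Implicit Types (t s a : R) (z x : 'rV[int]_d) (h : seq 'rV[int]_d).

(* In this section [t] is the height above the bottom of a slab of width [L]. *)
Let pos t := Num.max t 0.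

Let pos_ge0 t : 0 <= pos t. Proof. by rewrite le_max lexx orbT. Qed.

Let d2_gt0 : 0 < (2 * d)%:R :> R. Proof. by rewrite ltr0n muln_gt0. Qed.
Let dR_gt0 : 0 < d%:R :> R. Proof. by rewrite ltr0n. Qed.
Let L2_gt0 : 0 < L + 2. Proof. by move: L_ge1; lra. Qed.

(** Brownian motion killed inside the slab and free below it crosses the slab with
    probability [cosh (theta t) / cosh (theta L)] from above the bottom, and with
    the value at [t = 0] from below. For the walk the flat part extends up to height 1 because a walk just below the slab can jump
    that far, and no gain may occur where there is no killing. *)
Definition exit_profile t : R := coshR (theta * pos (t - 1)).

Lemma exit_profile_gt0 t : 0 < exit_profile t.
Proof. exact: coshR_gt0. Qed.

Lemma exit_profile_le t t' : t <= t' -> exit_profile t <= exit_profile t'.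
Proof.
move=> tt'; apply: ler_coshR; first by rewrite mulr_ge0.
rewrite ler_wpM2l // /pos ge_max le_max (le_trans (lerB tt' (lexx 1))) //=.
by rewrite le_max lexx orbT.
Qed.

(** Flattening lowers both shifted values below those of the [cosh] that agrees
    with the profile at [t]; the addition formula does the rest. *)
Lemma exit_profile_pair t s :
  exit_profile (t + s) + exit_profile (t - s) <= 2 * exit_profile t * coshR (theta * s).
Proof.
pose b := pos (t - 1).
have shift r : exit_profile (t + r) <= coshR (theta * (b + r)).
  rewrite -[leRHS]coshR_abs; apply: ler_coshR; first by rewrite mulr_ge0.
  rewrite normrM [`|theta|]ger0_norm // ler_wpM2l //.
  have := ler_norm (b + r); have := normr_ge0 (b + r); rewrite /b /pos.
  by case: (leP (t - 1) 0) => ?; case: (leP (t + r - 1) 0) => ?; lra.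
apply: le_trans (lerD (shift s) (shift (- s))) _.
by rewrite !mulrDr mulrN coshR_mulD.
Qed.

Lemma exit_profile_drift t :
  step_mean (fun e => exit_profile (t + dotZ u (unit_step e)))
  <= expR kappa * exit_profile t.
Proof.
pose A := exit_profile t * (theta ^+ 2 * expR theta).
have F0 := exit_profile_gt0 t.
apply: (@le_trans _ _ (exit_profile t + A / (2 * d)%:R)).
  apply: step_mean_pair => // s s1.
  apply: le_trans (exit_profile_pair _ _) _.
  have -> : 2 * exit_profile t + A * s ^+ 2 =
    2 * exit_profile t * (1 + (theta * s) ^+ 2 / 2 * expR theta).
    by rewrite /A; field.
  apply: ler_wpM2l; first by rewrite mulr_ge0 // ltW.
  apply: (le_trans (coshR_le _)).
  rewrite lerD2l ler_wpM2l ?divr_ge0 ?sqr_ge0 // ler_expR normrM ger0_norm //.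
  by rewrite ler_piMr.
have -> : exit_profile t + A / (2 * d)%:R =
    exit_profile t * (1 + theta ^+ 2 * expR theta / (2 * d)%:R).
  by rewrite /A; ring.
rewrite [leRHS]mulrC ler_pM2l //; apply: (le_trans _ (expR_ge1Dx kappa)).
by rewrite lerD2l ler_pdivrMr // [kappa * _]mulrC.
Qed.

Lemma exit_profile_drift0 t : t <= 0 ->
  step_mean (fun e => exit_profile (t + dotZ u (unit_step e)))
  <= exit_profile t.
Proof.
move=> t0; rewrite -[leRHS](step_mean_cst d_gt0); apply: ler_step_mean => e.
have := dotZ_step_le1 u_unit e; rewrite ler_norml => /andP[_ s1].
rewrite /exit_profile /pos !max_r ?lexx //; lra.
Qed.

(** Bounds the expected time spent in the slab before leaving it at the top. The
    factor [pos t + 1] matters near the bottom: [r (r + 1)] is non-positive on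
    [-1, 0], so truncating it there does not spoil the drift. *)
Definition slab_clock t : R := d%:R * ((L + 1) * (L + 2) - pos t * (pos t + 1)).

Lemma slab_clock_ge0 t : t <= L + 1 -> 0 <= slab_clock t.
Proof.
move=> tL; rewrite mulr_ge0 ?ler0n // subr_ge0 ler_pM ?addr_ge0 //.
  by rewrite ge_max tL /=; move: L_ge1; lra.
suff : pos t <= L + 1 by lra.
by rewrite ge_max tL /=; move: L_ge1; lra.
Qed.

Lemma slab_clock_le t : slab_clock t <= d%:R * ((L + 1) * (L + 2)).
Proof. by rewrite ler_wpM2l ?ler0n // gerBl mulr_ge0 ?addr_ge0. Qed.

Lemma slab_clock_drift0 t : t < 0 ->
  step_mean (fun e => slab_clock (t + dotZ u (unit_step e))) <= slab_clock t.
Proof.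
move=> t0; rewrite -[leRHS](step_mean_cst d_gt0); apply: ler_step_mean => e.
have -> : slab_clock t = d%:R * ((L + 1) * (L + 2)).
  by rewrite /slab_clock /pos max_r ?(ltW t0) // mul0r subr0.
exact: slab_clock_le.
Qed.

Lemma slab_clock_drift t : 0 <= t ->
  step_mean (fun e => slab_clock (t + dotZ u (unit_step e)))
  <= slab_clock t - 1.
Proof.
move=> t0.
have -> : slab_clock t - 1 = slab_clock t + (- (2 * d)%:R) / (2 * d)%:R.
  by rewrite mulNr divff ?gt_eqF.
apply: step_mean_pair => // s; rewrite ler_norml => /andP[s1 s2].
have low r : -1 <= r -> r * (r + 1) <= pos r * (pos r + 1).
  by rewrite /pos; case: (leP r 0) => ? ? //; nra.
rewrite /slab_clock [pos t]max_l // natrM.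
have H1 := low (t + s); have H2 := low (t - s).
have : (t + s) * (t + s + 1) + (t - s) * (t - s + 1) <=
   pos (t + s) * (pos (t + s) + 1) + pos (t - s) * (pos (t - s) + 1).
  by apply: lerD; [apply: H1 | apply: H2]; lra.
rewrite -(ler_pM2l dR_gt0).
by move=> H; rewrite -subr_ge0; move: H; rewrite -subr_ge0; congr (0 <= _); ring.
Qed.

(** Bounds the probability of coming back to a site of the slab, from height [t]
    above that site, before leaving the slab at the top. *)
Definition return_bound t : R := 1 - pos t / (L + 2).

(** Bounds from below the probability that the walk, once at a site of the slab,
    leaves the slab at the top without coming back to that site. *)
Definition escape : R := ((2 * d)%:R * (L + 2))^-1.

Lemma return_bound_ge0 t : t <= L + 1 -> 0 <= return_bound t.
Proof.
move=> tL; rewrite subr_ge0 ler_pdivrMr // mul1r ge_max; apply/andP; split; move: L_ge1; lra.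
Qed.

Lemma return_bound0 : return_bound 0 = 1.
Proof. by rewrite /return_bound /pos maxxx mul0r subr0. Qed.

Lemma return_bound_drift t :
  step_mean (fun e => return_bound (t + dotZ u (unit_step e))) <= return_bound t.
Proof.
rewrite -[leRHS]addr0 -[X in _ + X](mul0r (2 * d)%:R^-1).
apply: step_mean_pair => // s _; rewrite /return_bound mul0r addr0.
have : 2 * pos t / (L + 2) <= (pos (t + s) + pos (t - s)) / (L + 2).
  rewrite ler_pM2r ?invr_gt0 // /pos.
  by case: (leP t 0); case: (leP (t + s) 0); case: (leP (t - s) 0) => ???; lra.
by rewrite [leRHS]mulrDl -mulrA => H; lra.
Qed.

Lemma return_bound_escape :
  step_mean (fun e => return_bound (dotZ u (unit_step e))) <= 1 - escape.
Proof.
have -> : 1 - escape = 1 + (- (L + 2)^-1) / (2 * d)%:R.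
  by rewrite /escape invfM mulNr mulrC.
have := @step_mean_pair R d d_gt0 u u_unit return_bound 1 (- (L + 2)^-1) 0.
under eq_fun do rewrite add0r.
apply => s s1; rewrite !add0r /return_bound.
have : s ^+ 2 / (L + 2) <= (pos s + pos (- s)) / (L + 2).
  rewrite ler_pM2r ?invr_gt0 //.
  have -> : pos s + pos (- s) = `|s|.
    by rewrite /pos; case: (ger0P s); case: (leP s 0); case: (leP (- s) 0) => ???;
      lra.
  by rewrite -real_normK ?num_real // expr2 ler_piMr.
rewrite [leRHS]mulrDl mulNr => H; lra.
Qed.

Lemma escape_gt0 : 0 < escape. Proof. by rewrite invr_gt0 mulr_gt0. Qed.

Lemma escape_lt1 : escape < 1.
Proof.
rewrite invf_lt1 ?mulr_gt0 //.
have : 1 <= (2 * d)%:R :> R by rewrite (ler_nat _ 1) muln_gt0.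
by move=> ?; move: L_ge1; nra.
Qed.

Let rho := 1 - escape.
Let rho_gt0 : 0 < rho. Proof. by rewrite subr_gt0 escape_lt1. Qed.

Variable y : 'rV[int]_d.

(** A site with [c] past visits is visited in the saturated state only if the walk
    reaches it and then comes back [N - c] more times, each time with probability
    at most [rho]. Up to the factor [rho ^+ N] this adds those probabilities over
    the slab sites seen so far. *)
Definition revisit_sum a z h : R :=
  \sum_(x <- undup h | a <= dotZ u x)
    rho ^- count_mem x h * return_bound (dotZ u z - dotZ u x).

Lemma revisit_sum_ge0 a z h : dotZ u z <= a + L + 1 -> 0 <= revisit_sum a z h.
Proof.
move=> zL; apply: sumr_ge0 => x ax; rewrite mulr_ge0 ?invr_ge0 ?exprn_ge0 ?(ltW rho_gt0) //.
by apply: return_bound_ge0; lra.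
Qed.

Let sum_undup_cons (T : eqType) (z : T) (h : seq T) (P : pred T) (F : T -> R) :
  \sum_(x <- undup (z :: h) | P x) F x =
  (if P z then F z else 0) + \sum_(x <- undup h | P x && (x != z)) F x.
Proof.
rewrite [LHS]big_mkcond /=; case: ifP => zh.
  rewrite (bigD1_seq z) ?mem_undup ?undup_uniq //=; congr (_ + _).
  by rewrite -big_mkcondl.
rewrite big_cons; congr (_ + _); rewrite -big_mkcond.
rewrite big_seq_cond [RHS]big_seq_cond; apply: eq_bigl => x.
rewrite mem_undup; case: (eqVneq x z) => [->|_]; last by rewrite andbT.
by rewrite zh.
Qed.

Lemma revisit_sum_cons a z z' h :
  revisit_sum a z' (z :: h) =
  (if a <= dotZ u z
   then rho ^- (count_mem z h).+1 * return_bound (dotZ u z' - dotZ u z) else 0) +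
  \sum_(x <- undup h | (a <= dotZ u x) && (x != z))
    rho ^- count_mem x h * return_bound (dotZ u z' - dotZ u x).
Proof.
rewrite /revisit_sum sum_undup_cons /= eqxx add1n; congr (_ + _).
apply: eq_bigr => x /andP[_ xz]; congr (rho ^- _ * _).
by rewrite eq_sym (negPf xz).
Qed.

Lemma revisit_sum_split a z h :
  revisit_sum a z h =
  (if (z \in h) && (a <= dotZ u z) then rho ^- count_mem z h else 0) +
  \sum_(x <- undup h | (a <= dotZ u x) && (x != z))
    rho ^- count_mem x h * return_bound (dotZ u z - dotZ u x).
Proof.
have [zh|zh] := boolP (z \in h).
  have := sum_undup_cons z h (fun x => a <= dotZ u x)
    (fun x => rho ^- count_mem x h * return_bound (dotZ u z - dotZ u x)).
  by rewrite /= zh subrr return_bound0 mulr1.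
rewrite /= add0r /revisit_sum big_seq_cond [RHS]big_seq_cond.
apply: eq_bigl => x; rewrite mem_undup.
by case: (eqVneq x z) => [->|_]; rewrite ?andbT // (negPf zh).
Qed.

Lemma revisit_sum_mem a z h : z \in h -> a <= dotZ u z ->
  dotZ u z <= a + L + 1 -> rho ^- count_mem z h <= revisit_sum a z h.
Proof.
move=> zh az zL; rewrite revisit_sum_split zh az /= lerDl sumr_ge0 // => x /andP[ax _].
rewrite mulr_ge0 ?invr_ge0 ?exprn_ge0 ?(ltW rho_gt0) //.
by apply: return_bound_ge0; lra.
Qed.

(** Leaving a slab site for the [c]-th time multiplies its term by [rho ^-1], and
    the chance of return is at most [rho]; so the only gain is the term of a site
    visited for the first time. *)
Lemma revisit_sum_drift a z h :
  step_mean (fun e => revisit_sum a (z + unit_step e) (z :: h))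
  <= revisit_sum a z h + (if a <= dotZ u z then 1 else 0).
Proof.
under eq_fun do rewrite revisit_sum_cons dotZD.
rewrite step_meanD step_mean_sum revisit_sum_split addrAC; apply: lerD; last first.
  apply: ler_sum => x _; rewrite step_meanZ ler_pM2l ?invr_gt0 ?exprn_gt0 //.
  under eq_fun do rewrite addrAC.
  exact: return_bound_drift.
case: (boolP (a <= dotZ u z)) => az; last by rewrite step_mean_cst // andbF addr0.
under eq_fun do rewrite addrAC subrr add0r.
rewrite step_meanZ andbT.
apply: (@le_trans _ _ (rho ^- count_mem z h)).
  rewrite exprS invfM [X in X * _]mulrC -mulrA -[leRHS]mulr1.
  rewrite ler_pM2l ?invr_gt0 ?exprn_gt0 // mulrC ler_pdivrMr // mul1r.
  exact: return_bound_escape.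
by have [zh|zh] := boolP (z \in h); rewrite ?lerDl // (count_memPn zh) expr0 invr1 add0r.
Qed.

(** A supersolution for the walk that crosses the slab of heights between [a] and
    [a + L]: the first term bounds the crossing probability when no site is
    saturated, the second the probability that some site is. Each newly visited
    site costs [rho ^+ N], which is paid by one tick of the clock. *)
Definition slab_potential a z h : R :=
  exit_profile (dotZ u z - a) / exit_profile L +
  rho ^+ N * (slab_clock (dotZ u z - a) + revisit_sum a z h).

(** The value of the potential at the bottom of an unvisited slab. *)
Definition slab_factor : R :=
  (exit_profile L)^-1 + rho ^+ N * (d%:R * ((L + 1) * (L + 2))).

Lemma slab_potential_ge0 a z h : dotZ u z <= a + L + 1 ->
  0 <= slab_potential a z h.
Proof.
move=> zL; rewrite addr_ge0 //.
  by rewrite divr_ge0 // ltW // exit_profile_gt0.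
rewrite mulr_ge0 ?exprn_ge0 ?(ltW rho_gt0) // addr_ge0 ?revisit_sum_ge0 //.
by apply: slab_clock_ge0; lra.
Qed.

Lemma slab_potential_top a z h : a + L <= dotZ u z -> dotZ u z <= a + L + 1 ->
  1 <= slab_potential a z h.
Proof.
move=> z_top zL; rewrite -[leLHS]addr0 lerD //.
  by rewrite ler_pdivlMr ?exit_profile_gt0 // mul1r exit_profile_le //; lra.
rewrite mulr_ge0 ?exprn_ge0 ?(ltW rho_gt0) // addr_ge0 ?revisit_sum_ge0 //.
by apply: slab_clock_ge0; lra.
Qed.

Lemma slab_potential_drift a z h :
  visit_weight kappa N z h = expR (- kappa) \/ dotZ u z < a ->
  dotZ u z <= a + L ->
  visit_weight kappa N z h *
    step_mean (fun e => slab_potential a (z + unit_step e) (z :: h))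
  <= slab_potential a z h.
Proof.
move=> w_z zL.
have w_le1 : visit_weight kappa N z h <= 1.
  by rewrite /visit_weight; case: ifP => // _; rewrite expR_le1 oppr_le0.
have w_ge0 : 0 <= visit_weight kappa N z h.
  by rewrite /visit_weight; case: ifP => // _; rewrite expR_ge0.
have shift e : dotZ u (z + unit_step e) - a = dotZ u z - a + dotZ u (unit_step e).
  by rewrite dotZD addrAC.
rewrite /slab_potential; under eq_fun do rewrite shift.
rewrite step_meanD mulrDr; apply: lerD.
  under eq_fun do rewrite mulrC.
  rewrite step_meanZ mulrCA [leRHS]mulrC ler_pM2l ?invr_gt0 ?exit_profile_gt0 //.
  case: w_z => [->|za].
    by rewrite expRN ler_pdivrMl ?expR_gt0 // exit_profile_drift.
  apply: (le_trans _ (exit_profile_drift0 _)); last by lra.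
  rewrite ler_piMl // -(step_mean_cst d_gt0 0); apply: ler_step_mean => e.
  exact/ltW/exit_profile_gt0.
rewrite step_meanZ step_meanD mulrCA ler_pM2l ?exprn_gt0 //.
set m := (X in _ * X); suff m_le : m <= slab_clock (dotZ u z - a) + revisit_sum a z h.
  apply: (le_trans _ m_le); rewrite ler_piMl //.
  rewrite /m -step_meanD -(step_mean_cst d_gt0 0); apply: ler_step_mean => e.
  have := dotZ_step_le1 u_unit e; rewrite ler_norml => /andP[_ s1].
  rewrite addr_ge0 ?slab_clock_ge0 ?revisit_sum_ge0 ?dotZD //; lra.
rewrite /m; case: (ltP (dotZ u z) a) => za.
  have := revisit_sum_drift a z h; rewrite (lt_geF za) /= addr0 => H.
  by rewrite lerD // slab_clock_drift0 // subr_lt0.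
have := revisit_sum_drift a z h; rewrite za => H.
have := @slab_clock_drift (dotZ u z - a); rewrite subr_ge0 => /(_ za) G; lra.
Qed.

Lemma hit_value_ge0 M z h : 0 <= hit_value kappa N y M z h.
Proof.
elim: M z h => [|M IH] z h /=; case: ifP => // _.
rewrite mulr_ge0 // /visit_weight; first by case: ifP => // _; rewrite expR_ge0.
by rewrite -(step_mean_cst d_gt0 0); apply: ler_step_mean => e.
Qed.

Lemma hit_value_le1 M z h : hit_value kappa N y M z h <= 1.
Proof.
elim: M z h => [|M IH] z h /=; case: ifP => // _.
rewrite mulr_ile1 //.
- by rewrite /visit_weight; case: ifP => // _; rewrite expR_ge0.
- rewrite -(step_mean_cst d_gt0 0); apply: ler_step_mean => e.
  exact: hit_value_ge0.
- by rewrite /visit_weight; case: ifP => // _; rewrite expR_le1 oppr_le0.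
- by rewrite -(step_mean_cst d_gt0 1); apply: ler_step_mean.
Qed.

Lemma slab_factor_ge0 : 0 <= slab_factor.
Proof.
rewrite addr_ge0 ?invr_ge0 ?(ltW (exit_profile_gt0 _)) // mulr_ge0 //.
  by rewrite exprn_ge0 // ltW.
by rewrite mulr_ge0 ?ler0n // mulr_ge0 //; move: L_ge1; lra.
Qed.

(** The bound [B] serves twice: at the top of the slab, and at the first
    saturated visit, where the potential is at least 1 and no finer comparison is available. *)
Lemma hit_value_slab a B : 0 <= B -> a + L <= dotZ u y ->
  (forall M z h, {in h, forall x, dotZ u x < a + L} ->
     dotZ u z <= a + L + 1 -> hit_value kappa N y M z h <= B) ->
  forall M z h, {in h, forall x, dotZ u x < a + L} ->
     dotZ u z <= a + L + 1 ->
     hit_value kappa N y M z h <= B * slab_potential a z h.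
Proof.
move=> B0 ya IH M; elim: M => [|M IHM] z h hL zL.
all: have Pge0 := slab_potential_ge0 h zL.
all: case: (leP (a + L) (dotZ u z)) => z_top.
1,3: by apply: le_trans (IH _ _ _ hL zL) _; rewrite ler_peMr // slab_potential_top.
all: have zy : z == y = false by apply/negP => /eqP zy; move: ya z_top; rewrite zy; lra.
all: rewrite /= zy.
1: by rewrite mulr_ge0.
have [[za satur]|unsat] : (a <= dotZ u z /\ (N <= count_mem z h)%N) \/
    (visit_weight kappa N z h = expR (- kappa) \/ dotZ u z < a).
- case: (leP a (dotZ u z)) => za; last by right; right.
  by rewrite /visit_weight; case: (ltnP _ N) => ?; [right; left | left].
- have := IH M.+1 z h hL zL; rewrite /= zy => /le_trans; apply.
  have zh : z \in h by rewrite -has_pred1 has_count (leq_trans N_gt0).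
  rewrite ler_peMr // -[leLHS]add0r lerD //.
    by rewrite divr_ge0 // ltW // exit_profile_gt0.
  rewrite -(@mulfV _ (rho ^+ N)) ?expf_neq0 ?gt_eqF // ler_pM2l ?exprn_gt0 //.
  apply: (@le_trans _ _ (revisit_sum a z h)); last first.
    by rewrite lerDr slab_clock_ge0 //; lra.
  apply: (le_trans _ (revisit_sum_mem zh za zL)).
  rewrite lef_pV2 ?posrE ?exprn_gt0 // ler_wiXn2l // ?(ltW rho_gt0) //.
  by rewrite gerBl ltW // escape_gt0.
apply: (@le_trans _ _ (visit_weight kappa N z h *
    step_mean (fun e => B * slab_potential a (z + unit_step e) (z :: h)))).
  apply: ler_wpM2l; first by rewrite /visit_weight; case: ifP => // _; rewrite expR_ge0.
  apply: ler_step_mean => e; apply: IHM.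
    by move=> x; rewrite inE => /predU1P[->//|]; exact: hL.
  have := dotZ_step_le1 u_unit e; rewrite ler_norml dotZD => /andP[_ s1]; lra.
rewrite step_meanZ mulrCA ler_wpM2l // slab_potential_drift //; lra.
Qed.

(** Each slab is entered unvisited and contributes a factor. What happens below
    the current slab is free of charge, so the past only has to lie below it. *)
Theorem hit_value_le_slabs (K M : nat) a z h :
  {in h, forall x, dotZ u x < a} -> dotZ u z <= a + 1 ->
  a + K%:R * L <= dotZ u y ->
  hit_value kappa N y M z h <= slab_factor ^+ K.
Proof.
elim: K M a z h => [|K IH] M a z h ha za ya.
  by rewrite expr0 hit_value_le1.
have L_gt0 : 0 < L by move: L_ge1; lra.
have KL : 0 <= K%:R * L by rewrite mulr_ge0 ?ler0n // ltW.
have haL : {in h, forall x, dotZ u x < a + L} by move=> x /ha; lra.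
rewrite exprSr; apply: le_trans (@hit_value_slab a (slab_factor ^+ K) _ _ _ M z h haL _) _.
- by rewrite exprn_ge0 // slab_factor_ge0.
- by move: ya; rewrite -natr1 mulrDl mul1r; lra.
- move=> M' z' h' hL' zL'; apply: IH hL' zL' _.
  by move: ya; rewrite -natr1 mulrDl mul1r; lra.
- by lra.
rewrite ler_wpM2l ?exprn_ge0 ?slab_factor_ge0 //.
rewrite lerD //.
  rewrite -[leRHS]mul1r ler_pM2r ?invr_gt0 ?exit_profile_gt0 //.
  by rewrite /exit_profile /pos max_r ?mulr0 /coshR ?oppr0 ?expR0; lra.
rewrite ler_pM2l ?exprn_gt0 // /revisit_sum big_seq_cond big_pred0 ?addr0.
  exact: slab_clock_le.
move=> x; rewrite mem_undup; case: (boolP (x \in h)) => //= /ha.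
by rewrite ltNge => /negPf.
Qed.

End slab.

(** * Integrals and independence *)

Section integral_lemmas.
Context {disp : measure_display} {T : measurableType disp} {R : realType}.
Variable P : probability T R.
Local Open Scope ereal_scope.
Import HBNNSimple.

(** The integral of a non-negative function is a supremum over the simple
    functions below it, so it is monotone even without measurability. *)
Lemma le_integral_nonmeasurable (f g : T -> \bar R) :
  (forall w, 0 <= f w) -> (forall w, f w <= g w) ->
  \int[P]_w f w <= \int[P]_w g w.
Proof.
move=> f0 fg; have g0 w : 0 <= g w by apply: le_trans (fg w).
rewrite !ge0_integralTE //; apply: ub_ereal_sup => _ [h hf <-].
by apply: ereal_sup_ubound; exists h => // w; apply: le_trans (fg w).
Qed.

(** Independence from events extends to functions: by linearity to simple
    functions, by monotone convergence to non-negative ones. *)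
Lemma integral_mul_indep (X : {RV P >-> R}) (Y : T -> R) (f : R -> R) :
  measurable_fun setT Y -> (forall w, 0 <= Y w)%R ->
  \int[P]_w (Y w)%:E \is a fin_num ->
  measurable_fun setT f -> (forall v, 0 <= f v)%R ->
  (forall A : set R, measurable A ->
    \int[P]_w (\1_A (X w) * Y w)%:E = P (X @^-1` A) * \int[P]_w (Y w)%:E) ->
  \int[P]_w (f (X w) * Y w)%:E =
    \int[P]_w (f (X w))%:E * \int[P]_w (Y w)%:E.
Proof.
move=> mY Y0 Yfin mf f0 indep.
have mX : measurable_fun setT X by exact: measurable_funPT.
have mXA (A : set R) : measurable A -> measurable (X @^-1` A).
  by move=> mA; rewrite -[_ @^-1` _]setTI; exact: mX.
have int1 (g : R -> R) : \int[P]_w (g (X w) * 1)%:E = \int[P]_w (g (X w))%:E.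
  by apply: eq_integral => w _; rewrite mulr1.
have simple (h : {nnsfun R >-> R}) : \int[P]_w (h (X w) * Y w)%:E =
    \int[P]_w (h (X w))%:E * \int[P]_w (Y w)%:E.
  pose B r := h @^-1` [set r]; pose s : seq R := finmap.enum_fset (fset_set (range h)).
  have mB r : measurable (B r) by exact: measurable_sfunP.
  have hE v : h v = (\sum_(r <- s) `|r| * \1_(B r) v)%R.
    rewrite (fimfunE h) fsbig_finite //= big_seq [RHS]big_seq.
    apply: eq_bigr => r; rewrite in_fset_set // => /set_mem[v' _ <-].
    by rewrite ger0_norm.
  have level (g : T -> R) : measurable_fun setT g -> (forall w, 0 <= g w)%R ->
      \int[P]_w (h (X w) * g w)%:E = \sum_(r <- s)
        `|r|%:E * \int[P]_w (\1_(B r) (X w) * g w)%:E.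
    move=> mg g0.
    have mr r : measurable_fun setT (fun w => (\1_(B r) (X w) * g w)%:E).
      apply/measurable_EFinP/measurable_funM => //.
      by apply: measurableT_comp => //; exact: measurable_indic.
    under eq_integral => w _.
      rewrite hE mulr_suml -sumEFin.
      under eq_bigr do rewrite -mulrA EFinM.
      over.
    rewrite ge0_integral_sum //; last 2 first.
    - by move=> r; exact: measurable_funeM.
    - by move=> r w _; rewrite -EFinM lee_fin !mulr_ge0.
    by apply: eq_bigr => r _; rewrite ge0_integralZl_EFin // => w _;
      rewrite lee_fin mulr_ge0.
  rewrite level // -(int1 h).
  rewrite (level (cst 1%R)) // ge0_sume_distrl; last first.
    move=> r _; rewrite mule_ge0 // integral_ge0 // => w _.
    by rewrite lee_fin mulr_ge0.
  apply: eq_bigr => r _; rewrite indep // -muleA; congr (_ * (_ * _)).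
  rewrite -[X @^-1` _]setIT -integral_indic //; last exact: mXA.
have mfE : measurable_fun setT (EFin \o f) by exact/measurable_EFinP.
pose a := nnsfun_approx measurableT mfE.
have a_cvg v : EFin \o a ^~ v @ \oo --> (f v)%:E.
  by apply: cvg_nnsfun_approx => // ? _; rewrite lee_fin.
have a_nd v : {homo a ^~ v : m n / (m <= n)%N >-> (m <= n)%R}.
  by move=> m n mn; exact/lefP/nd_nnsfun_approx.
have mono (g : T -> R) : measurable_fun setT g -> (forall w, 0 <= g w)%R ->
    \int[P]_w (a n (X w) * g w)%:E @[n --> \oo] --> \int[P]_w (f (X w) * g w)%:E.
  move=> mg g0.
  have -> : \int[P]_w (f (X w) * g w)%:E =
      \int[P]_w limn (fun n => (a n (X w) * g w)%:E).
    apply: eq_integral => w _; apply/esym/cvg_lim => //.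
    rewrite EFinM; under eq_fun do rewrite EFinM.
    by apply: cvgeZr => //; exact: a_cvg.
  apply: cvg_monotone_convergence => //.
  - move=> n; apply/measurable_EFinP/measurable_funM => //.
    exact: measurableT_comp.
  - by move=> n w _; rewrite lee_fin mulr_ge0.
  - by move=> w _ m n mn; rewrite lee_fin ler_wpM2r // a_nd.
have lim_prod : \int[P]_w (a n (X w) * Y w)%:E @[n --> \oo] -->
    \int[P]_w (f (X w))%:E * \int[P]_w (Y w)%:E.
  under eq_fun do rewrite simple -(int1 (a _)).
  by apply: cvgeZr => //; rewrite -int1; apply: (mono (cst 1%R)).
exact: cvg_unique (mono _ mY Y0) lim_prod.
Qed.

End integral_lemmas.

Section independence.
Context {disp : measure_display} {T : measurableType disp} {R : realType}.
Variable P : probability T R.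
Local Open Scope ereal_scope.

Lemma integral01_fin_num (Y : T -> R) : measurable_fun setT Y ->
  (forall w, 0 <= Y w <= 1)%R -> \int[P]_w (Y w)%:E \is a fin_num.
Proof.
move=> mY Y01; have Y0 w : (0 <= Y w)%R by case/andP: (Y01 w).
rewrite ge0_fin_numE; last by apply: integral_ge0 => w _; rewrite lee_fin.
apply: (@le_lt_trans _ _ (\int[P]_w (cst 1 w))).
  by apply: le_integral_nonmeasurable => w; rewrite lee_fin //; case/andP: (Y01 w).
by rewrite integral_cst // mul1e; have := probability_setT P; move=> /= ->; rewrite ltry.
Qed.

Variables (I : choiceType) (X : I -> {RV P >-> R}).

(** One function at a time is traded for its expectation, the others being
    indicators already or functions still to be traded; the induction starts at
    the product rule for events. *)
Lemma integral_prod_indep_indic (J1 J2 : seq I) (f : I -> R -> R)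
    (A : I -> set R) :
  mutually_independent P (fun i => preimage_set_system setT (X i) measurable) ->
  uniq (J1 ++ J2) ->
  (forall i, measurable_fun setT (f i)) -> (forall i v, 0 <= f i v <= 1)%R ->
  (forall i, measurable (A i)) ->
  \int[P]_w (\prod_(i <- J1) f i (X i w) * \prod_(i <- J2) \1_(A i) (X i w))%:E =
  \prod_(i <- J1) \int[P]_w (f i (X i w))%:E *
  \prod_(i <- J2) P (X i @^-1` A i).
Proof.
move=> indep + mf f01; have f0 i v : (0 <= f i v)%R by case/andP: (f01 i v).
have mX i : measurable_fun setT (X i) by exact: measurable_funPT.
have mXA i (B : set R) : measurable B -> measurable (X i @^-1` B).
  by move=> mB; rewrite -[_ @^-1` _]setTI; exact: mX.
elim: J1 J2 A => [|i J1 IH] J2 A uJ mA.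
  under eq_integral do rewrite big_nil mul1r.
  rewrite big_nil mul1e -indep //; last first.
    move=> i _; exists (A i) => //.
    by rewrite setTI.
  rewrite bigcap_seq.
  have indicE_prod (J : seq I) w : (\prod_(i <- J) \1_(A i) (X i w))%R =
      \1_(\big[setI/setT]_(i <- J) X i @^-1` A i) w :> R.
    elim: J => [|i J IHJ]; first by rewrite !big_nil indicT.
    by rewrite !big_cons indicI /= IHJ !indicE.
  under eq_integral do rewrite indicE_prod.
  rewrite integral_indic ?setIT //.
  by apply: bigsetI_measurable => i _; exact: mXA.
move: uJ => /= /andP[iJ uJ].
pose Y w := (\prod_(j <- J1) f j (X j w) * \prod_(j <- J2) \1_(A j) (X j w))%R.
have indic01 (B : set R) v : (0 <= (\1_B v : R) <= 1)%R.
  by rewrite indicE; case: (_ \in _); rewrite ?ler01 ?lexx.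
have prod01 (J : seq I) (g : I -> R) : (forall j, 0 <= g j <= 1)%R ->
    (0 <= \prod_(j <- J) g j <= 1)%R.
  move=> g01; rewrite prodr_ge0 /=; last by move=> j _; case/andP: (g01 j).
  by rewrite prodr_ile1 // => j _.
have Y01 w : (0 <= Y w <= 1)%R.
  have /andP[a0 a1] := prod01 J1 (fun j => f j (X j w)) (fun j => f01 _ _).
  have /andP[b0 b1] := prod01 J2 (fun j => \1_(A j) (X j w)) (fun j => indic01 _ _).
  by rewrite /Y mulr_ge0 // mulr_ile1.
have mY : measurable_fun setT Y.
  apply: measurable_funM; apply: measurable_prod => j _.
    exact: measurableT_comp.
  by apply: measurableT_comp => //; exact: measurable_indic.
under eq_integral do rewrite big_cons -mulrA -/(Y _).
rewrite integral_mul_indep //; first last.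
- move=> B mB; pose A' j := if j == i then B else A j.
  have A'E (j : I) : j \in J1 ++ J2 -> A' j = A j.
    by move=> jJ; rewrite /A'; case: eqVneq jJ => // -> ; rewrite (negPf iJ).
  have := IH (i :: J2) A'; rewrite !big_cons {1 3}/A' eqxx.
  have -> : (\prod_(j <- J2) P (X j @^-1` A' j)) = \prod_(j <- J2) P (X j @^-1` A j).
    rewrite big_seq [RHS]big_seq; apply: eq_bigr => j jJ.
    by rewrite A'E // mem_cat jJ orbT.
  rewrite muleCA -(IH J2 A uJ mA) => <-.
  + apply: eq_integral => w _; rewrite big_cons /A' eqxx mulrCA; congr (_ * (_ * _))%:E.
    rewrite big_seq [RHS]big_seq; apply: eq_bigr => j jJ.
    by rewrite -/(A' j) A'E // mem_cat jJ orbT.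
  + by rewrite -cat1s uniq_catCA /= iJ.
  + by move=> j; rewrite /A'; case: ifP.
- exact: integral01_fin_num.
- by move=> w; case/andP: (Y01 w).
by rewrite IH // big_cons muleA.
Qed.

Lemma integral_prod_indep (J : seq I) (f : I -> R -> R) :
  mutually_independent P (fun i => preimage_set_system setT (X i) measurable) ->
  uniq J ->
  (forall i, measurable_fun setT (f i)) -> (forall i v, 0 <= f i v <= 1)%R ->
  \int[P]_w (\prod_(i <- J) f i (X i w))%:E =
  \prod_(i <- J) \int[P]_w (f i (X i w))%:E.
Proof.
move=> indep uJ mf f01.
have := @integral_prod_indep_indic J [::] f (fun=> setT) indep.
rewrite cats0 big_nil mule1 => <- //.
by apply: eq_integral => w _; rewrite big_nil mulr1.
Qed.

Lemma integral_iid (i j : I) (f : R -> R) : iid X ->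
  measurable_fun setT f -> (forall v, 0 <= f v)%R ->
  \int[P]_w (f (X i w))%:E = \int[P]_w (f (X j w))%:E.
Proof.
move=> [_ ident] mf f0.
have mfE : measurable_fun setT (EFin \o f) by exact/measurable_EFinP.
have f0E v : 0 <= (EFin \o f) v by rewrite lee_fin.
have toLaw k : \int[P]_w (f (X k w))%:E =
    \int[distribution P (X k)]_v (EFin \o f) v.
  by rewrite ge0_integral_distribution.
rewrite !toLaw; apply: eq_measure_integral => B mB _; exact: ident.
Qed.

End independence.

Section annealed_weight.
Context {disp : measure_display} {T : measurableType disp} {R : realType}.
Variable P : probability T R.
Variable d : nat.
Variable V : 'rV[int]_d -> {RV P >-> R}.
Hypothesis V_iid : iid V.
Hypothesis V_ge0 : forall x w, 0 <= V x w.
Variables (kappa : R) (N : nat).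
Hypothesis N_gt0 : (0 < N)%N.

Fixpoint history_weight (h : seq 'rV[int]_d) : R :=
  if h is z :: h' then visit_weight kappa N z h' * history_weight h' else 1.

(** The charges paid visit by visit regroup into one factor per site. *)
Lemma history_weightE (h : seq 'rV[int]_d) :
  history_weight h =
  \prod_(x <- undup h) expR (- (kappa * (minn (count_mem x h) N)%:R)).
Proof.
pose g (h : seq 'rV[int]_d) x := expR (- (kappa * (minn (count_mem x h) N)%:R)).
rewrite -[RHS]/(\prod_(x <- undup h) g h x).
elim: h => [|z h IH]; first by rewrite big_nil.
rewrite [LHS]/= IH.
have g_other x : x != z -> g (z :: h) x = g h x.
  by move=> xz; rewrite /g /= eq_sym (negPf xz).
have g_z : g (z :: h) z = visit_weight kappa N z h * g h z.
  rewrite /g /visit_weight; set c := count_mem z h.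
  have -> : count_mem z (z :: h) = c.+1 by rewrite /= eqxx.
  case: ltnP => cN.
    by rewrite !(minn_idPl _) ?(ltnW cN) // -expRD -natr1; congr expR; ring.
  by rewrite mul1r (minn_idPr (leqW cN)).
rewrite /=; case: ifP => zh.
  rewrite !(bigD1_seq z) ?mem_undup ?undup_uniq //= g_z -mulrA.
  by congr (_ * (_ * _)); apply: eq_bigr => x /g_other.
have gz1 : g h z = 1 by rewrite /g (count_memPn (negbT zh)) min0n mulr0 oppr0 expR0.
rewrite big_cons g_z gz1 mulr1.
congr (_ * _); rewrite big_seq [RHS]big_seq; apply: eq_bigr => x.
rewrite mem_undup => xh; rewrite g_other //.
by apply: contraFneq zh => <-.
Qed.

Local Open Scope ereal_scope.

(** By independence the averaged weight of a path factors over its sites, and a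
    site visited [m] times contributes the Laplace transform of the potential at
    [m], which is at most its value at [minn m N]. *)
Lemma annealed_weight_le (h : seq 'rV[int]_d) :
  (forall n, (n <= N)%N ->
     \int[P]_w (expR (- (n%:R * V 0%R w)))%:E <= (expR (- (kappa * n%:R)))%:E) ->
  \int[P]_w (expR (- \sum_(x <- h) V x w))%:E <= (history_weight h)%:E.
Proof.
move=> laplace; rewrite history_weightE.
(* The absolute value keeps [f] within [0, 1] on the whole line. *)
pose f x (v : R) := expR (- ((count_mem x h)%:R * `|v|)).
have f01 x v : (0 <= f x v <= 1)%R.
  by rewrite expR_ge0 expR_le1 oppr_le0 mulr_ge0.
have mf x : measurable_fun setT (f x).
  apply: measurableT_comp => //; apply: measurableT_comp => //.
  exact: measurable_funM.
have -> : \int[P]_w (expR (- \sum_(x <- h) V x w))%:E =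
    \int[P]_w (\prod_(x <- undup h) f x (V x w))%:E.
  apply: eq_integral => w _; congr (_%:E).
  rewrite -sumrN expR_sum -big_undup_iterop_count; apply: eq_bigr => x _.
  rewrite /f ger0_norm // -mulrN expRM_natl.
  by rewrite Monoid.iteropE; elim: (count_mem x h) => //= n ->; rewrite exprS.
rewrite (integral_prod_indep (X := V) (f := f)) //; [|exact: V_iid.1|exact: undup_uniq].
rewrite -prodEFin.
rewrite big_seq [leRHS]big_seq.
suff /andP[] : 0 <= \prod_(i <- undup h | i \in undup h) \int[P]_w (f i (V i w))%:E <=
  \prod_(i <- undup h | i \in undup h) (expR (- (kappa * (minn (count_mem i h) N)%:R)))%:E by [].
apply: (big_ind2 (fun a b : \bar R => 0 <= a <= b)) => [|a b a' b'|x xh].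
- by rewrite lexx lee01.
- move=> /andP[a0 ab] /andP[a0' ab'].
  by rewrite mule_ge0 // lee_pmul.
apply/andP; split.
  by apply: integral_ge0 => w _; rewrite lee_fin; case/andP: (f01 x (V x w)).
rewrite (integral_iid x 0%R V_iid) //; last by move=> v; case/andP: (f01 x v).
apply: le_trans (laplace _ (geq_minr _ _)).
apply: le_integral_nonmeasurable => w; rewrite lee_fin ?expR_ge0 // /f ler_expR.
by rewrite lerN2 ger0_norm // ler_wpM2r // ler_nat geq_minl.
Qed.

End annealed_weight.

(** * Walks as words of steps *)

Section words.
Context {R : realType} {d : nat}.
Implicit Types (p : seq ('I_d * bool)) (y z : 'rV[int]_d) (h : seq 'rV[int]_d).

Fixpoint step_words n : seq (seq ('I_d * bool)) :=
  if n is n'.+1 then [seq e :: p | e <- enum {: 'I_d * bool}, p <- step_words n']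
  else [:: [::]].

Lemma mem_step_words n p : (p \in step_words n) = (size p == n).
Proof.
elim: n p => [|n IH] [|e p] //=.
  by apply/negbTE/negP => /allpairsP[[e p] []].
apply/allpairsP/idP => [[[e' p'] /= [_ + [_ ->]]]|szp]; first by rewrite IH.
by exists (e, p); rewrite mem_enum IH.
Qed.

Lemma sum_step_words (F : seq ('I_d * bool) -> R) n :
  \sum_(p <- step_words n.+1) F p = \sum_e \sum_(p <- step_words n) F (e :: p).
Proof. by rewrite /= big_allpairs_dep /= big_enum. Qed.

Fixpoint first_hit y z p : bool :=
  if p is e :: p' then (z != y) && first_hit y (z + unit_step e) p' else z == y.

(** Most recent position first, as in the states of [hit_value]; the final
    position is left out because the weight of a path stops before the hitting
    time. *)
Fixpoint past_of z p h : seq 'rV[int]_d :=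
  if p is e :: p' then past_of (z + unit_step e) p' (z :: h) else h.

Variables (kappa : R) (N : nat) (y : 'rV[int]_d).

Definition hit_mass n z h : R :=
  ((2 * d)%:R^-1) ^+ n *
    \sum_(p <- step_words n | first_hit y z p)
       history_weight kappa N (past_of z p h).

Lemma hit_massS n z h : hit_mass n.+1 z h =
  if z == y then 0
  else step_mean (fun e => hit_mass n (z + unit_step e) (z :: h)).
Proof.
rewrite /hit_mass big_mkcond sum_step_words /=; case: eqVneq => zy /=.
  by rewrite big1 ?mulr0 // => e _; rewrite big1.
rewrite exprS -mulrA; congr (_ * _); rewrite mulr_sumr.
by apply: eq_bigr => e _; rewrite [in RHS]big_mkcond.
Qed.

(** Links the recursion, which suits comparison arguments, with the sum over
    words of steps, in which the law of the walk is explicit. *)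
Lemma sum_hit_mass M z h :
  \sum_(n < M.+1) hit_mass n z h =
  history_weight kappa N h * hit_value kappa N y M z h.
Proof.
have mass0 z' h' : hit_mass 0 z' h' =
    if z' == y then history_weight kappa N h' else 0.
  by rewrite /hit_mass expr0 mul1r big_mkcond big_seq1.
elim: M z h => [|M IH] z h.
  by rewrite big_ord1 mass0 /=; case: ifP => _; rewrite ?mulr1 ?mulr0.
rewrite big_ord_recl mass0; under eq_bigr do rewrite hit_massS.
rewrite /=; case: eqVneq => zy; first by rewrite big1 // addr0 mulr1.
rewrite add0r -step_mean_sum.
under [in LHS]eq_fun do rewrite IH.
by rewrite step_meanZ /= -mulrA mulrCA.
Qed.

End words.

Section walk_paths.
Context {R : realType} {d : nat}.
Variables (e0 : 'I_d * bool) (s : nat -> 'rV[int]_d).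

Definition follows k (p : seq ('I_d * bool)) : Prop :=
  forall i, (i < size p)%N ->
    s (k + i).+1 - s (k + i)%N = unit_step (nth e0 p i).

Lemma follows_cons k e p : follows k (e :: p) ->
  s k + unit_step e = s k.+1 /\ follows k.+1 p.
Proof.
move=> sp; split.
  by have := sp 0%N isT; rewrite addn0 /= => <-; rewrite addrC subrK.
by move=> i ip; have := sp i.+1 ip; rewrite addnS.
Qed.

Lemma first_hit_follows y p k : follows k p ->
  s (k + size p)%N = y -> (forall i, (i < size p)%N -> s (k + i)%N != y) ->
  first_hit y (s k) p.
Proof.
elim: p k => [|e p IH] k sp /=; first by rewrite addn0 => ->.
move=> sy sny; have [-> sp'] := follows_cons sp.
have := sny 0%N isT; rewrite addn0 => -> /=; apply: IH => //.
  by rewrite addSnnS.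
by move=> i ip; rewrite addSnnS; exact: sny.
Qed.

Lemma sum_past_of (U : 'rV[int]_d -> R) p k h : follows k p ->
  \sum_(x <- past_of (s k) p h) U x =
  \sum_(x <- h) U x + \sum_(k <= i < k + size p) U (s i).
Proof.
elim: p k h => [|e p IH] k h sp /=; first by rewrite addn0 big_geq // addr0.
have [-> sp'] := follows_cons sp; rewrite IH // big_cons.
rewrite [in RHS]big_ltn; last by rewrite addnS ltnS leq_addr.
by rewrite addSnnS addrA [U _ + _]addrC.
Qed.

End walk_paths.

Lemma lee_sum_mem {R : realDomainType} (I : eqType) (s : seq I) (P : pred I)
    (F : I -> \bar R) i : i \in s -> P i -> (forall j, 0 <= F j)%E ->
  (F i <= \sum_(j <- s | P j) F j)%E.
Proof. by move=> si Pi F0; rewrite (big_rem i) //= Pi leeDl // sume_ge0. Qed.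

Section walk_measure.
Context {disp : measure_display} {W : measurableType disp} {R : realType}.
Variables (d : nat) (PW : probability W R) (S : nat -> W -> 'rV[int]_d).
Hypothesis S_walk : simple_random_walk PW S.
Variable e0 : 'I_d * bool.
Local Open Scope ereal_scope.

Let increment n w := (S n.+1 w - S n w)%R.

Lemma unit_step_norm1 (e : 'I_d * bool) : (\sum_i `|unit_step e ord0 i| = 1)%R.
Proof.
rewrite (bigD1 e.1) //= big1 => [|i ne_i].
  by rewrite !mxE !eqxx /= mulr1 normrX normrN1 expr1n addr0.
by rewrite !mxE eqxx (negPf ne_i) mulr0 normr0.
Qed.

Lemma unit_step_inj : injective (@unit_step d).
Proof.
move=> [i b] [j c] /rowP H; have := H i; rewrite !mxE !eqxx mulr1 /=.
case: (eqVneq i j) => [->|_]; last by rewrite mulr0 => /eqP; rewrite signr_eq0.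
by rewrite mulr1 => /signr_inj ->.
Qed.

Lemma measurable_increment n (x : 'rV[int]_d) :
  measurable [set w | increment n w = x].
Proof.
have [_ mS _ _] := S_walk.
have -> : [set w | increment n w = x] =
    \bigcup_(y in [set: 'rV[int]_d]) (S n @^-1` [set y] `&` S n.+1 @^-1` [set (x + y)%R]).
  apply/seteqP; split => w /=.
    by move=> <-; exists (S n w) => //; split => //=; rewrite subrK.
  by move=> [y _ [/= Sn Sn1]]; rewrite /increment Sn1 Sn addrK.
apply: countable_bigcupT_measurable; first exact: countableP.
by move=> y; exact: measurableI.
Qed.

Definition path_event (p : seq ('I_d * bool)) : set W :=
  [set w | follows e0 (S ^~ w) 0 p].

Lemma path_eventE p : path_event p =
  \bigcap_(i in [set` iota 0 (size p)])
    [set w | increment i w = unit_step (nth e0 p i)].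
Proof.
apply/seteqP; split => w H i.
  by rewrite /= mem_iota add0n => ip; exact: H.
by move=> ip; apply: H; rewrite /= mem_iota add0n.
Qed.

Lemma measurable_path_event p : measurable (path_event p).
Proof.
rewrite path_eventE bigcap_seq; apply: bigsetI_measurable => i _.
exact: measurable_increment.
Qed.

Lemma probability_path_event p :
  PW (path_event p) = (((2 * d)%:R^-1) ^+ size p)%:E.
Proof.
have [_ _ unif indep] := S_walk.
rewrite path_eventE indep ?iota_uniq //; last first.
  by move=> i _; exists [set unit_step (nth e0 p i)] => //; rewrite setTI.
under eq_bigr do rewrite unif ?unit_step_norm1 //.
rewrite prodEFin -{1}[size p]subn0 -/(index_iota 0 (size p)).
by rewrite prodr_const_nat subn0.
Qed.

Definition lattice_path : set W :=
  [set w | forall n, exists e, increment n w = unit_step e].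

Lemma lattice_path_as : measurable (~` lattice_path) /\ PW (~` lattice_path) = 0.
Proof.
have [_ _ unif _] := S_walk.
pose G n := \bigcup_(e in [set: 'I_d * bool]) [set w | increment n w = unit_step e].
have mG n : measurable (G n).
  by apply: fin_bigcup_measurable => // e _; exact: measurable_increment.
have d_gt0 : (0 < d)%N by case: e0 => i _; apply: leq_trans (ltn_ord i).
have G1 n : PW (G n) = 1.
  rewrite /G measure_fin_bigcup; last 3 first.
  - exact: finite_finset.
  - move=> e e' _ _ [w [/= we we']]; apply: unit_step_inj.
    by rewrite -we -we'.
  - by move=> e _; exact: measurable_increment.
  have -> : [set: 'I_d * bool] = [set` enum {: 'I_d * bool}].
    by apply/seteqP; split => e //= _; rewrite mem_enum.
  rewrite -fsbig_seq ?enum_uniq // big_enum /=.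
  under eq_bigr do rewrite unif ?unit_step_norm1 //.
  have := @step_mean_cst R d d_gt0 1%R; rewrite /step_mean mulr_sumr sumEFin.
  by under [in X in X -> _]eq_bigr do rewrite mulr1; move=> ->.
have -> : ~` lattice_path = \bigcup_n ~` G n.
  rewrite -setC_bigcap; congr (~` _); apply/seteqP; split => w H n.
    by move=> _; have [e] := H n; exists e.
  by have [e _] := H n I; exists e.
have mGC n : measurable (~` G n) by exact: measurableC.
split; first exact: bigcup_measurable.
apply: measure_negligible; first exact: bigcup_measurable.
apply: negligible_bigcup => n; exists (~` G n); split => //.
by have := probability_setC PW (mG n); rewrite G1 subee.
Qed.

(** On a lattice path the hitting time selects one word of steps, and its term
    alone is already the weight of the path; elsewhere the weight is at most 1. *)
Lemma path_weight_le (U : 'rV[int]_d -> R) (y : 'rV[int]_d) w :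
  (forall x, 0 <= U x)%R ->
  (path_weight U (S ^~ w) y)%:E <=
  \sum_(n <oo) \sum_(p <- step_words n | first_hit y 0%R p)
     (expR (- \sum_(x <- past_of 0%R p [::]) U x))%:E * (\1_(path_event p) w)%:E
  + (\1_(~` lattice_path) w)%:E.
Proof.
move=> U0.
pose t n := \sum_(p <- step_words n | first_hit y 0%R p)
  (expR (- \sum_(x <- past_of 0%R p [::]) U x))%:E * (\1_(path_event p) w)%:E.
rewrite -[X in _ <= X + _]/(\sum_(n <oo) t n).
have t_ge0 n : 0 <= t n.
  by apply: sume_ge0 => p _; rewrite -EFinM lee_fin mulr_ge0 ?expR_ge0.
have series_ge0 : 0 <= \sum_(n <oo) t n by apply: nneseries_ge0.
rewrite /path_weight /hitting_time; case: pselect => [hit|_]; last first.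
  by rewrite adde_ge0 // lee_fin.
case: ex_minnP => n /eqP Sn n_min.
have [lat|nlat] := boolP (w \in lattice_path); last first.
  rewrite [X in _ <= _ + X%:E]indicE in_setC nlat lee_paddl //.
  by rewrite lee_fin expR_le1 oppr_le0 sumr_ge0.
rewrite lee_paddr ?lee_fin //.
have [e eE] := choice (set_mem lat).
pose p := mkseq e n.
have szp : size p = n by rewrite size_mkseq.
have p_follows : follows e0 (S ^~ w) 0 p.
  by move=> i; rewrite szp => i_n; rewrite nth_mkseq // add0n; exact: eE.
have [S0 _ _ _] := S_walk.
have p_hit : first_hit y 0%R p.
  rewrite -(S0 w); apply: first_hit_follows p_follows _ _.
    by rewrite add0n szp.
  move=> i; rewrite szp add0n ltnNge => i_n; apply/eqP => Si.
  by move/negP : i_n; apply; apply: n_min; rewrite Si.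
apply: (le_trans _ (nneseries_lim_ge n.+1 (fun k _ _ => t_ge0 k))).
rewrite big_nat_recr //= lee_paddl ?sume_ge0 // /t.
have -> : (expR (- \sum_(0 <= k < n) U (S k w)))%:E =
    (expR (- \sum_(x <- past_of 0%R p [::]) U x))%:E * (\1_(path_event p) w)%:E.
  rewrite -(S0 w) (sum_past_of _ _ p_follows) big_nil add0r add0n szp.
  by rewrite indicE mem_set // mule1.
apply: (@lee_sum_mem _ _ _ _ (fun p =>
    (expR (- \sum_(x <- past_of 0%R p [::]) U x))%:E *
    (\1_(path_event p) w)%:E)) => //.
  by rewrite mem_step_words szp.
Qed.

(** Integrating the previous bound: a word of length [n] has probability
    [(2 d) ^ - n], and non-lattice paths have probability zero. *)
Lemma two_point_le (U : 'rV[int]_d -> R) (y : 'rV[int]_d) :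
  (forall x, 0 <= U x)%R ->
  two_point PW S U y <=
  \sum_(n <oo) \sum_(p <- step_words n | first_hit y 0%R p)
     ((2 * d)%:R^-1 ^+ n)%:E * (expR (- \sum_(x <- past_of 0%R p [::]) U x))%:E.
Proof.
move=> U0; rewrite /two_point unlock.
pose c p := (expR (- \sum_(x <- past_of 0%R p [::]) U x))%R.
apply: (@le_trans _ _ (\int[PW]_w
   (\sum_(n <oo) \sum_(p <- step_words n | first_hit y 0%R p)
     (c p)%:E * (\1_(path_event p) w)%:E + (\1_(~` lattice_path) w)%:E))).
  apply: le_integral_nonmeasurable => w; last exact: path_weight_le.
  by rewrite lee_fin /path_weight; case: hitting_time => // ?; exact: expR_ge0.
have mterm p : measurable_fun setT (fun w => (c p)%:E * (\1_(path_event p) w)%:E).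
  apply: measurable_funeM; apply/measurable_EFinP.
  exact/measurable_indic/measurable_path_event.
have term0 p w : 0 <= (c p)%:E * (\1_(path_event p) w)%:E.
  by rewrite -EFinM lee_fin mulr_ge0 ?expR_ge0.
have mn n : measurable_fun setT (fun w => \sum_(p <- step_words n | first_hit y 0%R p)
     (c p)%:E * (\1_(path_event p) w)%:E).
  by under eq_fun do rewrite -big_filter; exact: emeasurable_sum.
have [mlat lat0] := lattice_path_as.
rewrite ge0_integralD //; last 3 first.
- by move=> w _; apply: nneseries_ge0 => n _ _; exact: sume_ge0.
- by apply: ge0_emeasurable_sum => // n w _ _; exact: sume_ge0.
- exact/measurable_EFinP/measurable_indic.
have -> : \int[PW]_w (\1_(~` lattice_path) w)%:E = 0.
  by rewrite integral_indic // setIT.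
rewrite adde0.
rewrite integral_nneseries //; last by move=> n w _; exact: sume_ge0.
apply: lee_nneseries => n _.
  by move=> _; apply: integral_ge0 => w _; exact: sume_ge0.
under eq_integral do rewrite -big_filter.
rewrite ge0_integral_sum // big_filter big_seq_cond [leRHS]big_seq_cond.
apply: lee_sum => p /andP[]; rewrite mem_step_words => /eqP szp _.
have mp := measurable_path_event p.
have c_ge0 : (0 <= c p)%R by exact: expR_ge0.
rewrite ge0_integralZl_EFin //; last first.
  exact/measurable_EFinP/measurable_indic.
have -> : \int[PW]_w (\1_(path_event p) w)%:E = (((2 * d)%:R^-1) ^+ n)%:E.
  by rewrite integral_indic // setIT -szp; exact: probability_path_event.
by rewrite muleC.
Qed.

End walk_measure.

(** * Lower bounds on the Lyapunov exponent *)

Section norm_bounds.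
Context {R : realType} {d : nat}.
Variable Nm : 'rV[R]_d -> R.
Hypothesis Nm_norm : is_norm Nm.

Lemma is_norm0 : Nm 0 = 0.
Proof. by have [_ homog _] := Nm_norm; rewrite -(scale0r 0) homog normr0 mul0r. Qed.

Lemma is_normN x : Nm (- x) = Nm x.
Proof.
by have [_ homog _] := Nm_norm; rewrite -scaleN1r homog normrN1 mul1r.
Qed.

Lemma is_norm_ge0 x : 0 <= Nm x.
Proof.
have [_ _ tri] := Nm_norm; have := tri x (- x).
by rewrite subrr is_norm0 is_normN; lra.
Qed.

Lemma is_norm_cube (x : 'rV[R]_d) : (forall i, `|x ord0 i| <= 1) ->
  Nm x <= \sum_i Nm (delta_mx ord0 i).
Proof.
move=> x1; have [_ homog tri] := Nm_norm.
rewrite {1}[x]row_sum_delta.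
apply: (@le_trans _ _ (\sum_i Nm (x ord0 i *: delta_mx ord0 i))).
  elim/big_ind2 : _ => [|a b a' b' ab ab'|//]; first by rewrite is_norm0.
  exact: le_trans (tri _ _) (lerD ab ab').
by apply: ler_sum => i _; rewrite homog ler_piMl // is_norm_ge0.
Qed.

Lemma ler_of_harmonic (a c x : R) :
  (forall m : nat, a - c / m.+1%:R <= x) -> a <= x.
Proof.
move=> H; rewrite leNgt; apply/negP => xa.
have e0 : 0 < a - x by rewrite subr_gt0.
pose m := Num.truncn (`|c| / (a - x)).
have := H m; rewrite lerBlDr -lerBlDl ler_pdivlMr ?ltr0n //.
apply/negP; rewrite -ltNge; apply: le_lt_trans (ler_norm c) _.
by rewrite mulrC -ltr_pdivrMr // truncnS_gt.
Qed.

(** A linear lower bound on the lattice propagates to the whole space: a real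
    vector, blown up by [m], is within bounded distance of the lattice. *)
Lemma norm_ge_linear (u : 'rV[R]_d) (b : R) : 0 <= b ->
  (forall z : 'rV[int]_d, b * dotZ u z <= Nm (map_mx intr z)) ->
  forall x : 'rV[R]_d, b * (\sum_i u ord0 i * x ord0 i) <= Nm x.
Proof.
move=> b0 H x; have [_ homog tri] := Nm_norm.
pose U := \sum_i `|u ord0 i|; pose C := \sum_i Nm (delta_mx ord0 i).
apply: (@ler_of_harmonic _ (b * U + C)) => m.
pose M : R := m.+1%:R; have M0 : 0 < M by rewrite ltr0n.
pose z : 'rV[int]_d := map_mx Num.floor (M *: x).
pose r := map_mx intr z - M *: x.
have r1 i : `|r ord0 i| <= 1.
  rewrite !mxE; have := floor_le (M * x ord0 i); have := floorD1_gt (M * x ord0 i).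
  by rewrite intrD ler_norml; set f := (Num.floor _)%:~R => ??; apply/andP; split; lra.
have -> : Nm x = Nm (M *: x) / M by rewrite homog gtr0_norm // mulrC mulKf ?gt_eqF.
rewrite ler_pdivlMr // mulrBl divfK ?gt_eqF //.
have H1 : Nm (map_mx intr z) <= Nm (M *: x) + C.
  have -> : map_mx intr z = M *: x + r by rewrite /r addrC subrK.
  by apply: le_trans (tri _ _) _; rewrite lerD2l is_norm_cube.
have H2 : M * (\sum_i u ord0 i * x ord0 i) - U <= dotZ u z.
  rewrite mulr_sumr -sumrB; apply: ler_sum => i _.
  have -> : (z ord0 i)%:~R = M * x ord0 i + r ord0 i by rewrite /r !mxE; ring.
  rewrite mulrDr mulrCA lerD2l lerNl -mulrN.
  apply: le_trans (ler_norm _) _; rewrite normrM normrN.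
  by rewrite ler_piMr.
have := H z; have := ler_wpM2l b0 H2; rewrite mulrBr -/M => *; lra.
Qed.

End norm_bounds.

Section annealed_bound.
Context {dispT : measure_display} {T : measurableType dispT} {R : realType}.
Variable P : probability T R.
Context {dispW : measure_display} {W : measurableType dispW}.
Variables (d : nat) (PW : probability W R) (S : nat -> W -> 'rV[int]_d).
Hypotheses (d_gt0 : (0 < d)%N) (S_walk : simple_random_walk PW S).
Variable V : 'rV[int]_d -> {RV P >-> R}.
Hypotheses (V_iid : iid V) (V_ge0 : forall x w, 0 <= V x w).
Variable u : 'rV[R]_d.
Hypothesis u_unit : \sum_i u ord0 i ^+ 2 = 1.
Variables (kappa theta L : R) (N : nat).
Hypotheses (kappa_ge0 : 0 <= kappa) (theta_ge0 : 0 <= theta) (L_ge1 : 1 <= L).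
Hypothesis N_gt0 : (0 < N)%N.
Hypothesis theta_small : theta ^+ 2 * expR theta <= (2 * d)%:R * kappa.
Hypothesis laplace : forall n, (n <= N)%N ->
  (\int[P]_w (expR (- (n%:R * V 0%R w)))%:E <= (expR (- (kappa * n%:R)))%:E)%E.

Let factor : R := slab_factor (d := d) theta L N.

Lemma annealed_two_point_le (K : nat) (y : 'rV[int]_d) : K%:R * L <= dotZ u y ->
  (annealed_two_point P PW S V y <= (factor ^+ K)%:E)%E.
Proof.
move=> Ky; pose e0 : 'I_d * bool := (Ordinal d_gt0, false).
pose c p w := expR (- \sum_(x <- past_of 0 p [::]) V x w).
have c_ge0 p w : 0 <= c p w by exact: expR_ge0.
have mc p : measurable_fun setT (fun w => (c p w)%:E).
  apply/measurable_EFinP; apply: measurableT_comp => //.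
  apply: measurableT_comp => //; apply: measurable_sum => x.
  exact: measurable_funPT.
pose r n : R := ((2 * d)%:R^-1) ^+ n.
have r_ge0 n : 0 <= r n by rewrite exprn_ge0 // invr_ge0.
have trm_ge0 n p w : (0 <= (r n)%:E * (c p w)%:E)%E.
  by rewrite -EFinM lee_fin mulr_ge0.
have mtrm n p : measurable_fun setT (fun w => (r n)%:E * (c p w)%:E)%E.
  exact: measurable_funeM.
apply: (@le_trans _ _ (\int[P]_w \sum_(n <oo)
    \sum_(p <- step_words n | first_hit y 0 p) (r n)%:E * (c p w)%:E)%E).
  apply: le_integral_nonmeasurable => w.
    rewrite /two_point unlock; apply: integral_ge0 => w' _.
    by rewrite lee_fin /path_weight; case: hitting_time => // ?; exact: expR_ge0.
  exact: (two_point_le S_walk e0).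
rewrite integral_nneseries //; last 2 first.
- by move=> n; under eq_fun do rewrite -big_filter; exact: emeasurable_sum.
- by move=> n w _; exact: sume_ge0.
apply: (@le_trans _ _ (\sum_(n <oo) (hit_mass kappa N y n 0 [::])%:E)%E).
  apply: lee_nneseries => n _.
    by move=> _; apply: integral_ge0 => w _; exact: sume_ge0.
  under eq_integral do rewrite -big_filter.
  rewrite ge0_integral_sum // big_filter /hit_mass EFinM -sumEFin.
  rewrite ge0_sume_distrr; last first.
    move=> p _; rewrite lee_fin history_weightE.
    by apply: prodr_ge0 => x _; exact: expR_ge0.
  apply: lee_sum => p _; rewrite ge0_integralZl_EFin //; last by move=> w _; rewrite lee_fin.
  by rewrite lee_wpmul2l ?lee_fin //; exact: annealed_weight_le.
have mass_ge0 n : (0 <= (hit_mass kappa N y n 0 [::])%:E)%E.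
  rewrite lee_fin mulr_ge0 ?exprn_ge0 ?invr_ge0 // sumr_ge0 // => p _.
  by rewrite history_weightE; apply: prodr_ge0 => x _; exact: expR_ge0.
apply: lime_le; first by apply: is_cvg_nneseries => n _ _.
near=> M; rewrite big_mkord sumEFin lee_fin.
apply: (@le_trans _ _ (\sum_(n < M.+1) hit_mass kappa N y n 0 [::])).
  by rewrite big_ord_recr /= lerDl -lee_fin.
rewrite sum_hit_mass mul1r.
have dot0 : dotZ u 0 = 0 by apply: big1 => i _; rewrite mxE mulr0.
apply: (@hit_value_le_slabs R d d_gt0 u u_unit kappa theta L N kappa_ge0
  theta_ge0 L_ge1 N_gt0 theta_small y K M 0) => //.
  by rewrite dot0 add0r ler01.
by rewrite add0r.
Unshelve. all: by end_near. Qed.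

Hypothesis factor_lt1 : factor < 1.

Lemma slab_factor_gt0 : 0 < factor.
Proof.
rewrite ltr_pwDl ?invr_gt0 ?exit_profile_gt0 // mulr_ge0 //.
  by rewrite exprn_ge0 // subr_ge0 ltW // escape_lt1.
by rewrite mulr_ge0 ?ler0n // mulr_ge0 //; move: L_ge1; lra.
Qed.

(** The point [k z] lies beyond about [k (u . z) / L] slabs, so that many factors
    bound its two-point function; divide the logarithm by [k]. *)
Lemma annealed_lyapunov_ge (Nm : 'rV[R]_d -> R) (x : 'rV[R]_d) :
  annealed_lyapunov P PW S V Nm ->
  (- ln factor / L) * (\sum_i u ord0 i * x ord0 i) <= Nm x.
Proof.
move=> [Nm_norm Nm_lim].
have f0 := slab_factor_gt0; have L0 : 0 < L by move: L_ge1; lra.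
have lnf : 0 < - ln factor by rewrite oppr_gt0 ln_lt0 // f0.
have b0 : 0 <= - ln factor / L by rewrite divr_ge0 // ltW.
apply: norm_ge_linear => // z.
have [z0|z0] := leP (dotZ u z) 0.
  by apply: le_trans (is_norm_ge0 Nm_norm _); rewrite mulr_ge0_le0.
have dotk k : dotZ u (z *+ k) = dotZ u z *+ k.
  elim: k => [|k IH]; first by rewrite !mulr0n; apply: big1 => i _; rewrite mxE mulr0.
  by rewrite !mulrS dotZD IH.
apply: (@ler_of_harmonic _ _ (- ln factor)) => m; rewrite -lee_fin.
apply: (cvge_ge _ (Nm_lim z)).
exists m.+1 => // k /= mk.
have k0 : 0 < k%:R :> R by rewrite ltr0n (leq_trans _ mk).
pose a := k%:R * dotZ u z / L; pose K := Num.truncn a.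
have a0 : 0 <= a by rewrite divr_ge0 ?mulr_ge0 // ltW.
have aK : a - 1 <= K%:R.
  by rewrite lerBlDr natr1 ltW // truncnS_gt.
have Ky : K%:R * L <= dotZ u (z *+ k).
  by rewrite dotk -ler_pdivlMr // -[_ u z *+ k]mulr_natl -/a /K truncn_le.
have two_pt_ge0 : (0 <= annealed_two_point P PW S V (z *+ k))%E.
  apply: integral_ge0 => w _; rewrite /two_point unlock; apply: integral_ge0 => w' _.
  by rewrite lee_fin /path_weight; case: hitting_time => // ?; exact: expR_ge0.
have lne_le : (lne (annealed_two_point P PW S V (z *+ k)) <= (K%:R * ln factor)%:E)%E.
  rewrite mulr_natl -lnXn // -lne_EFin ?exprn_gt0 // lee_lne ?in_itv /= ?leey ?andbT //.
    exact: annealed_two_point_le.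
  by rewrite lee_fin exprn_ge0 // ltW.
apply: (@le_trans _ _ ((- k%:R^-1)%:E * (K%:R * ln factor)%:E)%E); last first.
  by rewrite EFinN !mulNe leeN2 lee_wpmul2l // lee_fin invr_ge0 ltW.
rewrite -EFinM lee_fin.
have -> : - k%:R^-1 * (K%:R * ln factor) = - ln factor * (K%:R / k%:R) by ring.
have -> : - ln factor / L * dotZ u z - - ln factor / m.+1%:R =
   - ln factor * (a / k%:R - m.+1%:R^-1).
  by rewrite /a; field; rewrite !gt_eqF // ltr0n.
apply: ler_wpM2l; first exact: ltW.
apply: (@le_trans _ _ ((a - 1) / k%:R)); last by rewrite ler_pM2r ?invr_gt0.
rewrite mulrBl mul1r lerD2l lerN2 lef_pV2 ?posrE ?ltr0n ?ler_nat //.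
by rewrite (leq_trans _ mk).
Qed.

End annealed_bound.

(** * Small disorder: the slab factor *)

Section slab_asymptotics.
Context {R : realType} (d : nat).
Hypothesis d_gt0 : (0 < d)%N.
Implicit Types (x q s c r eps : R).

Let dR_gt0 : 0 < d%:R :> R. Proof. by rewrite ltr0n. Qed.

Lemma expR_small s r : 0 <= s -> 1 < r ->
  exists2 q0, 0 < q0 & forall q, 0 < q -> q < q0 -> expR (s * q) <= r.
Proof.
move=> s0 r1; have lnr : 0 < ln r by rewrite ln_gt0.
have s1 : 0 < s + 1 by lra.
exists (ln r / (s + 1)); first by rewrite divr_gt0.
move=> q q0; rewrite ltr_pdivlMr // => qr.
rewrite -[leRHS]lnK ?posrE ?(lt_trans _ r1) // ler_expR; nra.
Qed.

Lemma theta_small_near s c : 0 <= s -> s ^+ 2 < (2 * d)%:R * c ->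
  exists2 q0, 0 < q0 & forall q, 0 < q -> q < q0 ->
    (s * q) ^+ 2 * expR (s * q) <= (2 * d)%:R * (c * q ^+ 2).
Proof.
set D : R := _%:R * c => s0 sD.
have s2 : 0 < s ^+ 2 + 1 by rewrite ltr_pwDr // sqr_ge0.
pose r := 1 + (D - s ^+ 2) / (s ^+ 2 + 1).
have r1 : 1 < r by rewrite ltrDl divr_gt0 // subr_gt0.
have sr : s ^+ 2 * r <= D.
  have -> : s ^+ 2 * r = D - (D - s ^+ 2) / (s ^+ 2 + 1).
    by rewrite /r; field; rewrite gt_eqF.
  by rewrite gerBl divr_ge0 ?subr_ge0 // ltW.
have [q0 q00 H] := expR_small s0 r1.
exists q0 => // q qp qq0; rewrite mulrA -/D exprMn mulrAC ler_pM2r ?exprn_gt0 //.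
by apply: (le_trans _ sr); rewrite ler_wpM2l ?sqr_ge0 // H.
Qed.

Lemma expR_cubic x : 0 < x -> expR (- x) <= (3 / x) ^+ 3.
Proof.
move=> x0; have -> : - x = 3%:R * - (x / 3) by field.
rewrite expRM_natl ler_pXn2r ?nnegrE ?expR_ge0 // ?divr_ge0 //; last exact: ltW.
rewrite expRN -[3 / x]invf_div lef_pV2 ?posrE ?expR_gt0 ?divr_gt0 //.
by apply: (le_trans _ (expR_ge1Dx _)); rewrite lerDr.
Qed.

(** In a slab of width of order [1 / q] a site has order [q] chance of not being
    revisited, so [eps / q ^ 2] visits have probability [exp (- eta / q)], which
    beats the order [1 / q ^ 2] sites that are met. *)
Lemma saturation_near (r0 eps e : R) : 0 < r0 -> 0 < eps -> 0 < e ->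
  exists2 q0, 0 < q0 & forall q, 0 < q -> q < q0 ->
    (1 - escape (d := d) (r0 / q)) ^+ Num.truncn (eps / q ^+ 2) *
      (d%:R * ((r0 / q + 1) * (r0 / q + 2))) <= e.
Proof.
move=> r00 eps0 e0.
pose eta := eps / (8 * d%:R * r0).
have eta0 : 0 < eta by rewrite divr_gt0 // !mulr_gt0.
pose C := (3 / eta) ^+ 3 * (d%:R * (2 * r0) ^+ 2).
have C0 : 0 < C.
  apply: mulr_gt0; first by rewrite exprn_gt0 // divr_gt0.
  by rewrite mulr_gt0 // exprn_gt0 // mulr_gt0.
exists (Num.min (r0 / 2) (Num.min (Num.min 1 (eps / 2)) (e / C))).
  by rewrite !lt_min !divr_gt0 //= ltr01.
move=> q q0; rewrite !lt_min => /and3P[qr /andP[q1 qeps] qe].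
set L := r0 / q; set N := Num.truncn _.
have L2 : 2 <= L by rewrite ler_pdivlMr // mulrC -ler_pdivlMr // ltW.
have L0 : 0 < L by lra.
have N_ge : eps / (2 * q ^+ 2) <= N%:R.
  have : eps / q ^+ 2 < N.+1%:R by exact: truncnS_gt.
  have : 1 <= eps / (2 * q ^+ 2).
    rewrite ler_pdivlMr ?mulr_gt0 ?exprn_gt0 // mul1r; nra.
  have -> : eps / q ^+ 2 = eps / (2 * q ^+ 2) + eps / (2 * q ^+ 2).
    by field; rewrite gt_eqF.
  rewrite -natr1; lra.
have esc_ge : q / (4 * d%:R * r0) <= escape (d := d) L.
  have d2_gt0 : 0 < (2 * d)%:R :> R by rewrite ltr0n muln_gt0.
  have L2_gt0 : 0 < L + 2 by lra.
  rewrite -[leLHS]invf_div lef_pV2 ?posrE; last 2 first.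
  - by rewrite divr_gt0 // !mulr_gt0.
  - by rewrite mulr_gt0.
  have -> : 4 * d%:R * r0 / q = (2 * d)%:R * (L + L).
    by rewrite /L natrM; field; rewrite gt_eqF.
  by rewrite ler_pM2l ?ltr0n ?muln_gt0 // lerD2l.
have esc_lt1 := escape_lt1 d_gt0 (ltW (lt_le_trans (ltr1n _ 2) L2)).
have pow_le : (1 - escape (d := d) L) ^+ N <= (3 / (eta / q)) ^+ 3.
  have eq0 : 0 < eta / q by rewrite divr_gt0.
  apply: (le_trans _ (expR_cubic eq0)).
  apply: (@le_trans _ _ (expR (- (escape (d := d) L)) ^+ N)).
    apply: lerXn2r; rewrite ?nnegrE ?expR_ge0 ?expR_ge1Dx //.
    by rewrite subr_ge0 ltW.
  rewrite -expRM_natl ler_expR mulrN lerN2.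
  have -> : eta / q = eps / (2 * q ^+ 2) * (q / (4 * d%:R * r0)).
    by rewrite /eta; field; rewrite !gt_eqF.
  by apply: ler_pM => //; rewrite divr_ge0 ?mulr_ge0 ?exprn_ge0 ?ltW.
have sz_le : d%:R * ((L + 1) * (L + 2)) <= d%:R * (2 * r0) ^+ 2 / q ^+ 2.
  have -> : d%:R * (2 * r0) ^+ 2 / q ^+ 2 = d%:R * ((2 * L) * (2 * L)).
    by rewrite /L; field; rewrite gt_eqF.
  by rewrite ler_pM2l // ler_pM //; lra.
apply: (@le_trans _ _ ((3 / (eta / q)) ^+ 3 * (d%:R * (2 * r0) ^+ 2 / q ^+ 2))).
  apply: ler_pM => //; first by rewrite exprn_ge0 // subr_ge0 ltW.
  by rewrite mulr_ge0 ?ler0n // mulr_ge0 //; lra.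
have -> : (3 / (eta / q)) ^+ 3 * (d%:R * (2 * r0) ^+ 2 / q ^+ 2) = C * q.
  by rewrite /C; field; rewrite !gt_eqF.
by rewrite mulrC -ler_pdivlMr // ltW.
Qed.

Lemma exit_profile_near s r0 : 0 <= s -> 0 < r0 ->
  exists2 q0, 0 < q0 & forall q, 0 < q -> q < q0 ->
    (exit_profile (s * q) (r0 / q))^-1 <= 5 / 2 * expR (- (s * r0)).
Proof.
move=> s0 r00; have [q0 q00 H] := @expR_small s (5 / 4) s0 ltac:(lra).
exists (Num.min q0 r0); first by rewrite lt_min q00.
move=> q qp; rewrite lt_min => /andP[qq0 qr].
have L1 : 1 <= r0 / q by rewrite ler_pdivlMr // mul1r ltW.
have := H q qp qq0; rewrite /exit_profile max_l; last by lra.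
have -> : s * q * (r0 / q - 1) = s * r0 - s * q by field; rewrite gt_eqF.
move=> E; have ->: 5 / 2 * expR (- (s * r0)) = (2 / 5 * expR (s * r0))^-1.
  by rewrite expRN; field; rewrite gt_eqF ?expR_gt0.
rewrite lef_pV2 ?posrE ?coshR_gt0 ?mulr_gt0 ?expR_gt0 // /coshR.
apply: (@le_trans _ _ (expR (s * r0 - s * q) / 2)); last first.
  by rewrite ler_pM2r // lerDl expR_ge0.
have inv_ge : 4 / 5 <= (expR (s * q))^-1.
  by rewrite -[leLHS]invf_div lef_pV2 // posrE ?expR_gt0.
by rewrite expRD expRN; have := expR_gt0 (s * r0); nra.
Qed.

Lemma slab_factor_near s c r0 eps :
  0 <= s -> s ^+ 2 < (2 * d)%:R * c -> 0 < r0 -> 0 < eps ->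
  exists2 q0, 0 < q0 & forall q, 0 < q -> q < q0 ->
    [/\ 1 <= r0 / q, (0 < Num.truncn (eps / q ^+ 2))%N,
        (s * q) ^+ 2 * expR (s * q) <= (2 * d)%:R * (c * q ^+ 2)
      & slab_factor (d := d) (s * q) (r0 / q) (Num.truncn (eps / q ^+ 2))
        <= 3 * expR (- (s * r0))].
Proof.
move=> s0 sc r00 eps0.
have [q1 q10 H1] := theta_small_near s0 sc.
have [q2 q20 H2] := exit_profile_near s0 r00.
have e0 : 0 < expR (- (s * r0)) / 2 by rewrite divr_gt0 ?expR_gt0.
have [q3 q30 H3] := saturation_near r00 eps0 e0.
exists (Num.min (Num.min q1 q2) (Num.min (Num.min q3 r0) (Num.min 1 eps))).
  by rewrite !lt_min q10 q20 q30 r00 eps0 ltr01.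
move=> q q0; rewrite !lt_min.
move=> /andP[/andP[qq1 qq2] /andP[/andP[qq3 qr] /andP[ql1 qeps]]].
split.
- by rewrite ler_pdivlMr // mul1r ltW.
- rewrite truncn_gt0 ler_pdivlMr ?exprn_gt0 // mul1r; nra.
- exact: H1.
have := H2 q q0 qq2; have := H3 q q0 qq3; rewrite /slab_factor => *; lra.
Qed.

End slab_asymptotics.

(** * Small disorder: the Laplace transform of the potential *)

Definition clip {R : realType} (A v : R) : R := Num.min `|v| A.

Section laplace.
Context {R : realType}.

Lemma clip_ge0 (A v : R) : 0 <= A -> 0 <= clip A v.
Proof. by move=> A0; rewrite le_min normr_ge0. Qed.

Lemma continuous_clip (A : R) : continuous (clip A).
Proof.
move=> v; apply: (@continuous_min _ _ (fun v => `|v|) (cst A)).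
  exact: norm_continuous.
exact: cvg_cst.
Qed.

Lemma clip_bounded (A : R) : 0 <= A -> exists M, forall v, `|clip A v| <= M.
Proof.
by move=> A0; exists A => v; rewrite ger0_norm ?clip_ge0 // ge_min lexx orbT.
Qed.

Lemma measurable_clip (A : R) : measurable_fun setT (clip A).
Proof. by apply: continuous_measurable_fun; exact: continuous_clip. Qed.

(** Only bounded functionals pass to the limit in distribution, but by monotone
    convergence clipping costs arbitrarily little, even when the mean is
    infinite. *)
Lemma expectation_clip_gt {dispQ : measure_display} {O : measurableType dispQ}
    (Q : probability O R) (V0 : {RV Q >-> R}) (c : R) :
  (forall w, 0 <= V0 w) -> (c%:E < 'E_Q[V0])%E ->
  exists2 A : R, 0 < A & (c%:E < 'E_Q[clip A \o V0])%E.
Proof.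
move=> V0ge0; rewrite unlock => cE; apply: contrapT => noA.
have le_c (n : nat) : (\int[Q]_w (clip n.+1%:R (V0 w))%:E <= c%:E)%E.
  rewrite leNgt; apply/negP => cn; apply: noA; by exists n.+1%:R.
have lim_clip : (\int[Q]_w (clip n.+1%:R (V0 w))%:E @[n --> \oo] -->
    \int[Q]_w (V0 w)%:E)%E.
  have -> : (\int[Q]_w (V0 w)%:E = \int[Q]_w limn (fun n => (clip n.+1%:R (V0 w))%:E))%E.
    apply: eq_integral => w _; apply/esym/cvg_lim => //.
    apply: cvg_near_cst; exists (Num.truncn (V0 w)) => // n /= Vn.
    rewrite /clip ger0_norm // min_l //; apply/ltW/(lt_le_trans (truncnS_gt _)).
    by rewrite ler_nat.
  apply: cvg_monotone_convergence => //.
  - move=> n; apply/measurable_EFinP; apply: measurableT_comp => //.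
    exact: measurable_clip.
  - by move=> n w _; rewrite lee_fin clip_ge0.
  - move=> w _ m n mn; rewrite lee_fin le_min ge_min lexx /= ge_min.
    by rewrite ler_nat ltnS mn orbT.
suff : (\int[Q]_w (V0 w)%:E <= c%:E)%E by rewrite leNgt cE.
by apply: (cvge_le _ lim_clip); apply: nearW.
Qed.

(** Because [exp (- x) <= 1 / (1 + x) <= 1 - x (1 - x)] and [1 - x >= r]. *)
Lemma expR_clip_le (x r : R) : 0 <= x -> x <= 1 - r -> expR (- x) + r * x <= 1.
Proof.
move=> x0 xr; have x1 : 0 < 1 + x by lra.
have : expR (- x) <= (1 + x)^-1.
  by rewrite expRN lef_pV2 ?posrE ?expR_gt0 // expR_ge1Dx.
have : (1 + x)^-1 <= 1 - x + x ^+ 2.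
  rewrite -[leLHS]mul1r ler_pdivrMr //; nra.
nra.
Qed.

(** As long as [n g] is small, the Laplace transform of the potential of strength
    [g] is no larger than that of the constant potential [c g], for every [c]
    below the mean of the limit: clip at [A], where the expansion of the
    exponential is accurate for [n g] below [eps]. *)
Lemma laplace_near {dispT : measure_display} {T : measurableType dispT}
    (P : probability T R) (V : R -> {RV P >-> R})
    {dispQ : measure_display} {O : measurableType dispQ} (Q : probability O R)
    (V0 : {RV Q >-> R}) (c : R) :
  (forall g w, 0 < g -> 0 <= V g w) -> (forall w, 0 <= V0 w) ->
  cvg_in_distribution (0 : R)^'+ P (fun g w => V g w / g) Q V0 ->
  0 <= c -> (c%:E < 'E_Q[V0])%E ->
  exists2 eps : R, 0 < eps & \forall g \near (0 : R)^'+,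
    forall n : nat, n%:R * g <= eps ->
    (\int[P]_w (expR (- (n%:R * V g w)))%:E <= (expR (- (c * g * n%:R)))%:E)%E.
Proof.
move=> Vge0 V0ge0 Vcvg c0 cE.
have [A A0 cA] := expectation_clip_gt V0ge0 cE.
have [c1 cc1 c1A] : exists2 c1 : R, c < c1 & (c1%:E < 'E_Q[clip A \o V0])%E.
  case: ('E_Q[_])%E cA => [m| |] //; last by move=> _; exists (c + 1); rewrite ?ltry ?ltrDl.
  by rewrite lte_fin => cm; exists ((c + m) / 2); rewrite ?lte_fin; lra.
pose r := c / c1; have c10 : 0 < c1 by apply: le_lt_trans cc1.
have r1 : r < 1 by rewrite ltr_pdivrMr // mul1r.
have r0 : 0 <= r by rewrite divr_ge0 // ltW.
exists ((1 - r) / A); first by rewrite divr_gt0 // subr_gt0.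
have mean_gt : \forall g \near (0 : R)^'+,
    (c1%:E < 'E_P[clip A \o (fun w => V g w / g)%R])%E.
  exact: (Vcvg _ (@continuous_clip A) (clip_bounded (ltW A0)) _
    (open_ereal_gt' c1A)).
near=> g.
have g0 : 0 < g by near: g; exact: nbhs_right_gt.
have : (c1%:E < \int[P]_w (clip A (V g w / g))%:E)%E.
  by near: g; move: mean_gt; rewrite unlock.
set m := (\int[P]_w _)%E => c1m n n_small.
pose k := r * (n%:R * g); have k0 : 0 <= k by apply: mulr_ge0 => //; rewrite mulr_ge0 // ltW.
have mV : measurable_fun setT (V g) by exact: measurable_funPT.
have mclip : measurable_fun setT (fun w => (clip A (V g w / g))%:E).
  apply/measurable_EFinP; apply: measurableT_comp; first exact: measurable_clip.
  exact: measurable_funM.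
have mexp : measurable_fun setT (fun w => (expR (- (n%:R * V g w)))%:E).
  apply/measurable_EFinP; apply: measurableT_comp => //.
  by apply: measurableT_comp => //; exact: measurable_funM.
set I := (\int[P]_w _)%E.
have I0 : (0 <= I)%E by apply: integral_ge0 => w _; rewrite lee_fin expR_ge0.
have sum_le : (I + k%:E * m <= 1)%E.
  rewrite -ge0_integralZl_EFin //; last by move=> w _; rewrite lee_fin clip_ge0 // ltW.
  rewrite -ge0_integralD //; last 2 first.
  - by move=> w _; rewrite -EFinM lee_fin mulr_ge0 // clip_ge0 // ltW.
  - exact: measurable_funeM.
  apply: (@le_trans _ _ (\int[P]_w cst 1 w)%E); last first.
    by rewrite integral_cst // mul1e; have := probability_setT P => /= ->.
  apply: le_integral_nonmeasurable => w.
    by rewrite -EFinM -EFinD lee_fin addr_ge0 ?expR_ge0 // mulr_ge0 // clip_ge0 // ltW.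
  rewrite -EFinM -EFinD lee_fin.
  set x := clip A (V g w / g).
  have x0 : 0 <= x by rewrite clip_ge0 // ltW.
  have xA : x <= A by rewrite ge_min lexx orbT.
  have gx : g * x <= V g w.
    rewrite mulrC -ler_pdivlMr // ge_min ger0_norm ?lexx //.
    by rewrite divr_ge0 ?Vge0 // ltW.
  pose X := n%:R * g * x.
  have X0 : 0 <= X by rewrite !mulr_ge0 // ltW.
  have Xr : X <= 1 - r.
    rewrite -[leRHS](@divfK _ A) ?gt_eqF //.
    by rewrite ler_pM // mulr_ge0 // ltW.
  apply: le_trans (expR_clip_le X0 Xr); rewrite lerD //.
    by rewrite ler_expR lerN2 /X -mulrA ler_wpM2l.
  by rewrite /k /X !mulrA.
have km : ((c * g * n%:R)%:E <= k%:E * m)%E.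
  have -> : c * g * n%:R = k * c1 by rewrite /k /r; field; rewrite gt_eqF.
  by rewrite EFinM lee_wpmul2l ?lee_fin // ltW.
apply: (@le_trans _ _ (1 - c * g * n%:R)%:E).
  by rewrite EFinB leeBrDr //; apply: le_trans sum_le; rewrite leeD2l.
by rewrite lee_fin expR_ge1Dx.
Unshelve. all: by end_near. Qed.

End laplace.

(** * The lower limit *)

Lemma limf_einf_ge {T : choiceType} {X : filteredType T} {R : realType}
    (f : X -> \bar R) (F : set_system X) (a : \bar R) :
  (\forall x \near F, a <= f x)%E -> (a <= limf_einf f F)%E.
Proof.
move=> af; rewrite limf_einfE.
apply: le_trans (ereal_sup_ubound _); last by exists [set x | (a <= f x)%E].
by apply: le_ereal_inf_tmp => _ [x ax <-].
Qed.

(** Approximating from below treats finite and infinite [v] alike. *)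
Lemma sqrte_mul_le {R : realType} (v X : \bar R) (a : R) :
  (0 <= v)%E -> 0 <= a -> (0 <= X)%E ->
  (forall s : R, 0 <= s -> ((s ^+ 2)%:E < v)%E -> ((s * a)%:E <= X)%E) ->
  (sqrte v * a%:E <= X)%E.
Proof.
move=> v0 + X0 H; rewrite le_eqVlt => /predU1P[<-|a0]; first by rewrite mule0.
case: v v0 H => [v| |] // v0 H; last first.
  suff -> : X = +oo%E by rewrite leey.
  apply: eq_infty => r; apply: (@le_trans _ _ ((`|r| / a * a)%:E)).
    by rewrite lee_fin divfK ?gt_eqF // ler_norm.
  by apply: H; rewrite ?ltry // divr_ge0 // ltW.
rewrite /= -EFinM; move: v0; rewrite lee_fin le_eqVlt => /predU1P[<-|v0].
  by rewrite sqrtr0 mul0r.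
apply/lee_subgt0Pr => e e0.
pose s := Num.max 0 (Num.sqrt v - e / a).
have s0 : 0 <= s by rewrite le_max lexx.
have sv : s < Num.sqrt v by rewrite gt_max sqrtr_gt0 v0 gtrBl divr_gt0.
apply: le_trans (H s s0 _); last first.
  by rewrite lte_fin -[ltRHS]sqr_sqrtr ?ltW // ltr_pXn2r // nnegrE sqrtr_ge0.
rewrite -EFinB lee_fin.
have -> : Num.sqrt v * a - e = (Num.sqrt v - e / a) * a by field; rewrite gt_eqF.
by rewrite ler_pM2r // le_max lexx orbT.
Qed.

Section lower_bound.
Context {R : realType} (d : nat) (d_gt0 : (0 < d)%N).
Context {dispT : measure_display} {T : measurableType dispT} (P : probability T R).
Context {dispW : measure_display} {W : measurableType dispW} (PW : probability W R).
Variables (S : nat -> W -> 'rV[int]_d) (S_walk : simple_random_walk PW S).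
Variables (V : R -> 'rV[int]_d -> {RV P >-> R}).
Hypothesis V_iid : forall g : R, 0 < g -> iid (V g).
Hypothesis V_ge0 : forall g : R, 0 < g -> forall x w, 0 <= V g x w.
Context {dispQ : measure_display} {O : measurableType dispQ} (Q : probability O R).
Variables (V0 : {RV Q >-> R}) (V0_ge0 : forall w, 0 <= V0 w).
Hypothesis V_cvg : cvg_in_distribution (0 : R)^'+
            P (fun (g : R) (w : T) => V g 0 w / g) Q V0.
Variable beta : R -> 'rV[R]_d -> R.
Hypothesis beta_lyapunov :
  forall g : R, 0 < g -> annealed_lyapunov P PW S (V g) (beta g).

(** The slabs have width [r0 / sqrt g] and [theta = s sqrt g]. One slab then
    costs at most [3 exp (- s r0)], that is, [s r0 - ln 3] in the exponent per
    length [r0 / sqrt g]; the loss [ln 3 / r0] vanishes as [r0] grows. *)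
Lemma lyapunov_ratio_near (l : 'rV[R]_d) (s c r0 : R) :
  0 < l2norm l -> 0 <= s -> s ^+ 2 < (2 * d)%:R * c -> (c%:E < 'E_Q[V0])%E ->
  0 < r0 ->
  \forall g \near (0 : R)^'+,
    (s - ln 3 / r0) * l2norm l <= beta g l / Num.sqrt g.
Proof.
move=> l0 s0 sc cE r00.
have c0 : 0 <= c.
  have d2 : 0 < (2 * d)%:R :> R by rewrite ltr0n muln_gt0.
  by rewrite -(pmulr_rge0 _ d2) ltW // (le_lt_trans _ sc) // sqr_ge0.
have V0_ge g w : 0 < g -> 0 <= V g 0 w by move=> g0; exact: V_ge0.
have [eps eps0 laplace] := laplace_near (V := fun g => V g 0) V0_ge V0_ge0 V_cvg c0 cE.
have [q0 q00 slab] := slab_factor_near d_gt0 s0 sc r00 eps0.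
pose u : 'rV[R]_d := (l2norm l)^-1 *: l.
have l_sq : l2norm l ^+ 2 = \sum_i l ord0 i ^+ 2.
  by rewrite sqr_sqrtr // sumr_ge0 // => i _; rewrite sqr_ge0.
have u_unit : \sum_i u ord0 i ^+ 2 = 1.
  under eq_bigr do rewrite mxE exprMn.
  by rewrite -mulr_sumr -l_sq exprVn mulVf // expf_neq0 // gt_eqF.
have u_dot : \sum_i u ord0 i * l ord0 i = l2norm l.
  under eq_bigr do rewrite mxE -mulrA -expr2.
  by rewrite -mulr_sumr -l_sq expr2 mulKf // gt_eqF.
near=> g.
have g0 : 0 < g by near: g; exact: nbhs_right_gt.
pose q := Num.sqrt g; have q_gt0 : 0 < q by rewrite sqrtr_gt0.
have qg : q ^+ 2 = g by rewrite sqr_sqrtr // ltW.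
have qq0 : q < q0.
  rewrite -(ltr_pXn2r (n := 2)) // ?nnegrE ?ltW // qg.
  by near: g; apply: nbhs_right_lt; rewrite exprn_gt0.
have lap : forall n : nat, n%:R * g <= eps ->
    (\int[P]_w (expR (- (n%:R * V g 0%R w)))%:E <= (expR (- (c * g * n%:R)))%:E)%E.
  by near: g.
have [L1 N0 th factor_le] := slab q q_gt0 qq0.
have beta_norm := (beta_lyapunov g0).1.
have beta_ge0 : 0 <= beta g l / q by rewrite divr_ge0 ?(is_norm_ge0 beta_norm) // ltW.
have [small|large] := leP (s - ln 3 / r0) 0.
  by apply: le_trans beta_ge0; rewrite mulr_le0_ge0 // ltW.
have ln3 : ln 3 < s * r0 by move: large; rewrite subr_gt0 ltr_pdivrMr.
have factor_lt1 : 3 * expR (- (s * r0)) < 1.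
  rewrite expRN ltr_pdivrMr ?expR_gt0 // mul1r -ltr_ln ?posrE ?expR_gt0 //.
  by rewrite expRK.
have kap0 : 0 <= c * q ^+ 2 by rewrite mulr_ge0 ?sqr_ge0.
have th0 : 0 <= s * q by rewrite mulr_ge0 // ltW.
have lapN n : (n <= Num.truncn (eps / q ^+ 2))%N ->
    (\int[P]_w (expR (- (n%:R * V g 0%R w)))%:E
       <= (expR (- (c * q ^+ 2 * n%:R)))%:E)%E.
  move=> nN; rewrite qg; apply: lap; rewrite -ler_pdivlMr // -qg.
  by rewrite -truncn_ge_nat // divr_ge0 ?exprn_ge0 // ltW.
have := annealed_lyapunov_ge d_gt0 S_walk (V_iid g0) (V_ge0 g0) u_unit kap0 th0
  L1 N0 th lapN (le_lt_trans factor_le factor_lt1) l (beta_lyapunov g0).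
rewrite u_dot => beta_ge; rewrite ler_pdivlMr //.
apply: le_trans beta_ge; rewrite mulrAC ler_pM2r //.
have -> : (s - ln 3 / r0) * q = (s * r0 - ln 3) / (r0 / q).
  by field; rewrite !gt_eqF.
rewrite ler_pM2r ?invr_gt0 ?divr_gt0 //.
set f := slab_factor _ _ _ in factor_le *.
have f0 : 0 < f by exact: slab_factor_gt0.
rewrite -[s * r0]opprK -opprD lerN2.
apply: (@le_trans _ _ (ln (3 * expR (- (s * r0))))).
  by rewrite ler_ln ?posrE ?mulr_gt0 ?expR_gt0.
by rewrite lnM ?posrE ?expR_gt0 // expRK addrC.
Unshelve. all: by end_near. Qed.

End lower_bound.

Unset Implicit Arguments.

Theorem theorem3 (R : realType) (d : nat) (hd : (1 <= d)%N)
  (dispT : measure_display) (T : measurableType dispT) (P : probability T R)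
  (dispW : measure_display) (W : measurableType dispW) (PW : probability W R)
  (S : nat -> W -> 'rV[int]_d) (hS : simple_random_walk PW S)
  (V : R -> 'rV[int]_d -> {RV P >-> R})
  (Viid : forall g : R, 0 < g -> iid (V g))
  (Vge0 : forall g : R, 0 < g -> forall x w, 0 <= V g x w)
  (Vpos : forall g : R, 0 < g -> (0 < P [set w | (0 < V g 0 w)%R])%E)
  (dispQ : measure_display) (O : measurableType dispQ) (Q : probability O R)
  (V0 : {RV Q >-> R}) (V0ge0 : forall w, 0 <= V0 w)
  (Vcvg : cvg_in_distribution (0 : R)^'+
            P (fun (g : R) (w : T) => V g 0 w / g) Q V0)
  (beta : R -> 'rV[R]_d -> R)
  (hbeta : forall g : R, 0 < g -> annealed_lyapunov P PW S (V g) (beta g)) :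
  forall l : 'rV[R]_d,
    (sqrte ((2 * d)%:R%:E * 'E_Q[V0]) * (l2norm l)%:E
      <= limf_einf (fun g : R => (beta g l / Num.sqrt g)%:E) (0 : R)^'+)%E.
Proof.
move=> l.
have d2_gt0 : 0 < (2 * d)%:R :> R by rewrite ltr0n muln_gt0.
have EV0 : (0 <= 'E_Q[V0])%E.
  by rewrite unlock; apply: integral_ge0 => w _; rewrite lee_fin.
have l2_ge0 : 0 <= l2norm l by exact: sqrtr_ge0.
have lim_ge0 : (0 <= limf_einf (fun g : R => (beta g l / Num.sqrt g)%:E) (0 : R)^'+)%E.
  apply: limf_einf_ge; near=> g; rewrite lee_fin divr_ge0 ?sqrtr_ge0 //.
  by apply: is_norm_ge0; apply: (hbeta g _).1; near: g; exact: nbhs_right_gt.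
apply: sqrte_mul_le => //; first by rewrite mule_ge0 // lee_fin ltW.
move=> s s0 sE.
move: l2_ge0; rewrite le_eqVlt => /predU1P[<-|l2_gt0]; first by rewrite mulr0.
have [c sc cE] : exists2 c, s ^+ 2 < (2 * d)%:R * c & (c%:E < 'E_Q[V0])%E.
  pose x := s ^+ 2 / (2 * d)%:R.
  have s2E : s ^+ 2 = (2 * d)%:R * x by rewrite mulrC divfK ?gt_eqF.
  rewrite s2E; case: ('E_Q[V0])%E sE EV0 => [m| |] //; last first.
    by move=> _ _; exists (x + 1); rewrite ?ltry // ltr_pM2l // ltrDl.
  rewrite s2E -EFinM lte_fin ltr_pM2l // => xm _.
  by exists ((x + m) / 2); rewrite ?lte_fin ?ltr_pM2l //; lra.
apply/lee_subgt0Pr => e e0.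
(* This [r0] makes the loss [ln 3 / r0] times the norm of [l] equal to [e]. *)
have r0_gt0 : 0 < ln 3 * l2norm l / e :> R by rewrite divr_gt0 // mulr_gt0 // ln_gt0 // ltr1n.
apply: limf_einf_ge.
have := lyapunov_ratio_near hd hS Viid Vge0 V0ge0 Vcvg hbeta l2_gt0 s0 sc cE r0_gt0.
apply: filterS => g; rewrite -EFinB lee_fin; apply: le_trans.
have ln3 : 0 < ln 3 :> R by rewrite ln_gt0 // ltr1n.
suff -> : (s - ln 3 / (ln 3 * l2norm l / e)) * l2norm l = s * l2norm l - e by [].
by field; rewrite !gt_eqF.
Unshelve. all: by end_near. Qed.
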